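(* Let $p\in\mathbb Z_{>0}$ be odd and $r\in\mathbb C$. Then $$w_{p,r}=\Biggl(S_p\Bigl(-\tfrac{\alpha}{c_{L,\alpha}}\Bigr)+\sum_{k=1}^{\frac{p-1}2}\frac1k\Bigl(\sum_{i\ge0}\Psi\bigl(i+k-\tfrac p2\bigr)S_i\bigl(-\tfrac{\alpha}{2c_{L,\alpha}}\bigr)\Bigr)\Bigl(\sum_{j\ge0}\Psi\bigl(j-k-\tfrac p2\bigr)S_j\bigl(-\tfrac{\alpha}{2c_{L,\alpha}}\bigr)\Bigr)\Biggr)v_{p,r}$$ is a non-trivial subsingular vector, of conformal weight $h_{p,r}+p=h_{p,r-1}$, in $V[p,r]=\mathcal F_{p,r}$.
   Context: The $N=1$ Heisenberg-Virasoro algebra $\mathcal{SH}$ is the complex Lie superalgebra with even basis elements $L(n),\alpha(n)$ ($n\in\mathbb Z$), odd basis elements $G(n+\frac12),\Psi(n+\frac12)$ ($n\in\mathbb Z$), and even central elements $C_L,C_\alpha,C_{L,\alpha}$, with (super)commutators, for $m,n\in\mathbb Z$: $[\alpha(m),\alpha(n)]=\delta_{m+n,0}\,m\,C_\alpha$; $[L(m),\alpha(n)]=-n\,\alpha(m+n)-\delta_{m+n,0}(m^2+m)C_{L,\alpha}$; $[L(m),L(n)]=(m-n)L(m+n)+\delta_{m+n,0}\frac{m^3-m}{12}C_L$; $[\Psi(m+\frac12),\Psi(n+\frac12)]_+=\delta_{m+n+1,0}C_\alpha$; $[\alpha(m),\Psi(n+\frac12)]=0$; $[G(m+\frac12),G(n+\frac12)]_+=2L(m+n+1)+\delta_{m+n+1,0}\frac{m^2+m}{3}C_L$;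 $[L(m),G(n+\frac12)]=(\frac m2-n-\frac12)G(m+n+\frac12)$; $[\alpha(m),G(n+\frac12)]=m\,\Psi(m+n+\frac12)$; $[\Psi(m+\frac12),L(n)]=\frac{2m+n+1}{2}\Psi(m+n+\frac12)$; $[\Psi(m+\frac12),G(n+\frac12)]_+=\alpha(m+n+1)+2m\,\delta_{m+n+1,0}C_{L,\alpha}$. Let $\mathcal{SH}^{+}$ be the span of $L(n),\alpha(n),G(n-\frac12),\Psi(n-\frac12)$, $n\ge1$. A singular vector is a nonzero vector annihilated by $\mathcal{SH}^+$. A subsingular vector in a module $V$ is a vector which is not singular but whose image in $V/N$ is a (nonzero) singular vector for some submodule $N\subset V$. Fix $c_L,c_{L,\alpha}\in\mathbb C$ with $c_{L,\alpha}\ne0$. For $h,h_\alpha\in\mathbb C$, $V(h,h_\alpha)$ denotes the Verma module: the universal $\mathcal{SH}$-module generated by a vector $v$ with $\mathcal{SH}^+v=0$, $L(0)v=hv$, $\alpha(0)v=h_\alpha v$, on which $C_L,C_\alpha,C_{L,\alpha}$ act by $c_L,0,c_{L,\alpha}$. For $p,r\in\mathbb C$ put $h_{p,r}=(1-p^2)\frac{c_L-3}{24}-rp$ and $V[p,r]=V(h_{p,r},(1+p)c_{L,\alpha})$, with highest weight vector $v_{p,r}$. Conformal weight means $L(0)$-eigenvalue. For $p\notin\mathbb Z_{<0}$, $V[p,r]$ is identified with the Fock module $\mathcal F_{p,r}$ (to which it is isomorphic): the module over the Heisenberg algebra ($c(n),d(n)$; $\langle c,c\rangle=\langle d,d\rangle=0,\langle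 c,d\rangle=2$) and the fermions ($\Psi^\pm(s)$, $s\in\frac12+\mathbb Z$; $\{\Psi^+(s),\Psi^-(s')\}=\delta_{s+s',0}$, other anticommutators zero) generated by the vacuum $v_{p,r}=e^{-\frac{p+1}2\overline d+rc}$, $\overline d=d-\frac{c_L-3}{12}c$, with $\alpha(n)=-c_{L,\alpha}c(n)$, $\Psi(s)=-\sqrt2c_{L,\alpha}\Psi^-(s)$, and $L(z)$, $G(z)$ the fields of the vectors $\omega=\frac12c(-1)d(-1)+\frac{c_L-3}{24}c(-2)-\frac12d(-2)+\frac12\Psi^+(-\frac32)\Psi^-(-\frac12)+\frac12\Psi^-(-\frac32)\Psi^+(-\frac12)$ and $\tau=\sqrt2(\frac12c(-1)\Psi^+(-\frac12)+\frac12d(-1)\Psi^-(-\frac12)+\frac{c_L-3}{12}\Psi^-(-\frac32)-\Psi^+(-\frac32))$. Schur polynomials: $S_k(\beta)=S_k(\beta(-1),\beta(-2),\dots)$ are defined by $\exp\left(\sum_{n\ge1}\beta(-n)\frac{z^n}{n}\right)=\sum_{k\ge0}S_k(\beta)z^k$; $S_k(-\frac{\alpha}{tc_{L,\alpha}})$, $t=1,2$, is obtained by substituting $\beta(-n)=-\frac{1}{tc_{L,\alpha}}\alpha(-n)$. The sums over $i,j$ are finite on $v_{p,r}$ because $\Psi(s)v_{p,r}=0$ for $s>0$ and the operators $\Psi(s)$, $\alpha(n)$ mutually (anti)commute at level zero.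
   Formalization: The printed coefficient 1/k of the k-th product of Ψ-sums is replaced by 1/(2c_{L,α}²k); with 1/k the claim fails for odd p≥3 unless 2c_{L,α}²=1 (for p=3, G(5/2)G(1/2)w=(2−4c_{L,α}²)v, so w is not subsingular). *)

(* Defs.v *)
From mathcomp Require Import all_boot all_order all_algebra.
From mathcomp Require Import complex.
From mathcomp Require Import boolp classical_sets fsbigop reals.

Set Implicit Arguments.
Unset Strict Implicit.
Unset Printing Implicit Defensive.

Import Order.TTheory GRing.Theory Num.Theory.
Local Open Scope classical_set_scope.
Local Open Scope ring_scope.

(* The complex numbers are R[i] for R : realType.                             *)

(* The odd generators are indexed by the integer part of their mode:          *)
(*   SH_G n stands for G(n + 1/2) and SH_Psi n for Psi(n + 1/2).              *)
Inductive SHbasis :=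
  | SH_L of int | SH_alpha of int | SH_G of int | SH_Psi of int
  | SH_CL | SH_Calpha | SH_CLalpha.

Definition comm (U : zmodType) (f g : U -> U) (u : U) : U := f (g u) - g (f u).
Definition acomm (U : zmodType) (f g : U -> U) (u : U) : U := f (g u) + g (f u).

(* The brackets are imposed as identities between operators, so those in the  *)
(* opposite order follow by (anti)symmetry.                                   *)
Record SHmodule (R : realType) := {
  SHcarrier :> lmodType R[i];
  act : SHbasis -> {linear SHcarrier -> SHcarrier};
  SH_CL_central : forall x u, comm (act SH_CL) (act x) u = 0;
  SH_Calpha_central : forall x u, comm (act SH_Calpha) (act x) u = 0;
  SH_CLalpha_central : forall x u, comm (act SH_CLalpha) (act x) u = 0;
  SH_alpha_alpha : forall (m n : int) u,
    comm (act (SH_alpha m)) (act (SH_alpha n)) u =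
      ((m + n == 0)%:R * m%:~R) *: act SH_Calpha u;
  SH_L_alpha : forall (m n : int) u,
    comm (act (SH_L m)) (act (SH_alpha n)) u =
      - (n%:~R *: act (SH_alpha (m + n)) u)
      - ((m + n == 0)%:R * (m ^+ 2 + m)%:~R) *: act SH_CLalpha u;
  SH_L_L : forall (m n : int) u,
    comm (act (SH_L m)) (act (SH_L n)) u =
      (m - n)%:~R *: act (SH_L (m + n)) u
      + ((m + n == 0)%:R * ((m ^+ 3 - m)%:~R / 12%:R)) *: act SH_CL u;
  SH_Psi_Psi : forall (m n : int) u,
    acomm (act (SH_Psi m)) (act (SH_Psi n)) u =
      (m + n + 1 == 0)%:R *: act SH_Calpha u;
  SH_alpha_Psi : forall (m n : int) u,
    comm (act (SH_alpha m)) (act (SH_Psi n)) u = 0;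
  SH_G_G : forall (m n : int) u,
    acomm (act (SH_G m)) (act (SH_G n)) u =
      2%:R *: act (SH_L (m + n + 1)) u
      + ((m + n + 1 == 0)%:R * ((m ^+ 2 + m)%:~R / 3%:R)) *: act SH_CL u;
  SH_L_G : forall (m n : int) u,
    comm (act (SH_L m)) (act (SH_G n)) u =
      (m%:~R / 2%:R - n%:~R - 2%:R^-1) *: act (SH_G (m + n)) u;
  SH_alpha_G : forall (m n : int) u,
    comm (act (SH_alpha m)) (act (SH_G n)) u =
      m%:~R *: act (SH_Psi (m + n)) u;
  SH_Psi_L : forall (m n : int) u,
    comm (act (SH_Psi m)) (act (SH_L n)) u =
      ((2%:Z * m + n + 1)%:~R / 2%:R) *: act (SH_Psi (m + n)) u;
  SH_Psi_G : forall (m n : int) u,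
    acomm (act (SH_Psi m)) (act (SH_G n)) u =
      act (SH_alpha (m + n + 1)) u
      + ((m + n + 1 == 0)%:R * (2%:Z * m)%:~R) *: act SH_CLalpha u
}.

(* G(n - 1/2) and Psi(n - 1/2) with n >= 1 are SH_G k and SH_Psi k, k >= 0.   *)
Definition SHplus (x : SHbasis) : bool :=
  match x with
  | SH_L n | SH_alpha n => 1 <= n
  | SH_G n | SH_Psi n => 0 <= n
  | _ => false
  end.

Section Modules.
Variable R : realType.
Implicit Types V W : SHmodule R.

Definition SHsubmodule V (N : {pred V}) : Prop :=
  submod_closed N /\ forall x u, u \in N -> act V x u \in N.

Definition singular V (u : V) : Prop :=
  u != 0 /\ forall x, SHplus x -> act V x u = 0.

(* The image of u in V / N is nonzero iff u \notin N, and it is annihilated   *)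
(* by SH^+ iff SH^+ u is contained in N.                                      *)
Definition subsingular V (u : V) : Prop :=
  ~ singular u /\
  exists N : {pred V}, [/\ SHsubmodule N, u \notin N &
    forall x, SHplus x -> act V x u \in N].

Definition has_charges V (cL cLa : R[i]) : Prop :=
  forall u : V, [/\ act V SH_CL u = cL *: u, act V SH_Calpha u = 0 &
                    act V SH_CLalpha u = cLa *: u].

Definition highest_weight V (h ha : R[i]) (v : V) : Prop :=
  [/\ forall x, SHplus x -> act V x v = 0,
      act V (SH_L 0) v = h *: v & act V (SH_alpha 0) v = ha *: v].

(* V is the Verma module V(h, ha) and v its highest weight vector. Modules    *)
(* are not required to be Z/2-graded: the object defined by this universal    *)
(* property carries a grading, and it is also universal among graded modules. *)
Definition is_Verma (cL cLa h ha : R[i]) V (v : V) : Prop :=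
  [/\ has_charges V cL cLa,
      highest_weight h ha v,
      forall N : {pred V}, SHsubmodule N -> v \in N -> forall u, u \in N &
      forall W (w : W), has_charges W cL cLa -> highest_weight h ha w ->
        exists f : {linear V -> W},
          (forall x u, f (act V x u) = act W x (f u)) /\ f v = w].

Definition h_pr (cL p r : R[i]) : R[i] :=
  (1 - p ^+ 2) * ((cL - 3%:R) / 24%:R) - r * p.

Definition is_V_pr (cL cLa p r : R[i]) V (v : V) : Prop :=
  is_Verma cL cLa (h_pr cL p r) ((1 + p) * cLa) v.

(* The action of \sum_(n >= 1) beta(-n) z^n / n on V[[z]], where b n is the   *)
(* operator beta(-n) and F k is the coefficient of z^k.                       *)
Definition series_op V (b : nat -> V -> V) (F : nat -> V) : nat -> V :=
  fun k => \sum_(1 <= n < k.+1) n%:R^-1 *: b n (F (k - n)%N).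

(* S_k(beta) u, the coefficient of z^k in exp(\sum_n beta(-n) z^n / n) u. The *)
(* m-th power of the exponent starts at z^m, so only m <= k contributes.      *)
Definition schur V (b : nat -> V -> V) (k : nat) (u : V) : V :=
  \sum_(m < k.+1)
     (m`!)%:R^-1 *: iter m (series_op b) (fun j => if j == 0%N then u else 0) k.

(* beta(-n) = - alpha(-n) / (t c_{L,alpha})                                   *)
Definition beta V (cLa t : R[i]) (n : nat) (u : V) : V :=
  - (t * cLa)^-1 *: act V (SH_alpha (- n%:Z)) u.

(* \sum_(i >= 0) Psi(i + k - p/2) S_i(- alpha / (2 c_{L,alpha})) for odd p,   *)
(* where i + k - p/2 = (i + k - (p + 1)/2) + 1/2.                             *)
Definition Psi_S V (cLa : R[i]) (p : nat) (k : int) (u : V) : V :=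
  \sum_(i \in [set: nat])
     act V (SH_Psi (i%:Z + k - (p.+1)./2%:Z)) (schur (@beta V cLa 2%:R) i u).

(* The printed formula has coefficient 1/k, which is the coefficient for the  *)
(* free fermions Psi^-(s) = - Psi(s) / (sqrt 2 c_{L,alpha}); in terms of the  *)
(* generators Psi(s) it is 1 / (2 c_{L,alpha}^2 k). The correction is needed: *)
(* for p = 3 and coefficient a, G(5/2) G(1/2) w = (2 - 4 c_{L,alpha}^2 a) v,  *)
(* so the vector generates V, and is not subsingular, unless                  *)
(* 2 c_{L,alpha}^2 a = 1.                                                     *)
Definition w_pr V (cLa : R[i]) (p : nat) (v : V) : V :=
  schur (@beta V cLa 1) p v
  + \sum_(1 <= k < (p.-1)./2.+1)
      (2%:R * cLa ^+ 2 * k%:R)^-1 *: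
        Psi_S cLa p k%:Z (Psi_S cLa p (- k%:Z) v).

End Modules.

(* Main.v *)
(* Write c = c_{L,alpha}, p = 2q+1, E(z) = exp(-1/(2c) sum_n alpha(-n) z^n/n)    *)
(* and phi(z) = Psi(z) E(z).  On a highest weight vector v, the operator         *)
(* G(m+1/2) acts linearly on the coefficients of E and phi: it sends E_i v to a  *)
(* multiple of the coefficient of z^(i-m-1) in phi v, and that of z^j in phi v   *)
(* to 2c(q-j) E_(j-m) v.  Hence the coefficient u of z^q in phi v is             *)
(* singular, and since E(z)^2 = exp(-1/c sum_n alpha(-n) z^n/n), the vector w,   *)
(* quadratic in E and phi, satisfies G(m+1/2) w = -(1/c) E_(q-m) u.              *)
(*                                                                               *)
(* The universal property maps V[p,r] to a free field module F with h_{p,r}, by  *)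
(* v |-> vacuum, which shows u <> 0, so that w is not singular; and to a free    *)
(* field module with h_{p,r+1/2}, by v |-> u(vacuum), whose kernel N contains u  *)
(* because u is odd.  An annihilation operator of F applied to the image of w    *)
(* gives -(1/c) u(vacuum), so w is not in N, while SH^+ w is contained in N.     *)
(*                                                                               *)
(* In the free field module only the commutators of G with the free modes are    *)
(* computed.  The remaining relations follow because an operator that            *)
(* supercommutes with all the modes supercommutes with L(0), hence vanishes if   *)
(* its weight is nonzero.                                                        *)

Require Import Defs.
From HB Require Import structures.
From mathcomp Require Import all_boot all_order all_algebra.
From mathcomp Require Import complex zify ring lra.
From mathcomp Require Import boolp classical_sets functions fsbigop reals.

Set Implicit Arguments.
Unset Strict Implicit.
Unset Printing Implicit Defensive.

Import Order.TTheory GRing.Theory Num.Theory.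
Local Open Scope classical_set_scope.
Local Open Scope ring_scope.

(** Write p = 2q+1, c for c_{L,alpha}, E_i for S_i(-alpha/(2c)). The families E_i v and [phi i v]
    are carried into each other by the modes G(m+1/2), m >= 0 ([G_E], [G_phi]), and the scalar
    (1+p-2k)c in [G_phi] vanishes at k = q+1; hence u = [phi c q.+1 v] is killed by SH^+. As
    S_p(-alpha/c) is the sum of the E_i E_{p-i} ([schur_double]), G(m+1/2) maps it to -1/c times a
    sum over t of terms in E_{p-m-t} phi_t v. The fermion bilinears of w cancel these in pairs
    symmetric about t = q+1, and only the middle term, which involves u, survives ([G_w_pr]). The
    positive modes of alpha and Psi kill w outright. So w is annihilated by SH^+ modulo any
    submodule containing u, and it is not singular once u is nonzero.

    Both remaining facts, u nonzero and w outside some submodule containing u, are checked in free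
    field modules, where conjugate modes detect alpha and Psi. With v sent to the vacuum, a
    conjugate fermion mode recovers the vacuum from u ([phi_vac_neq0]). With v sent to the vector u
    of a vacuum of weight lower by p/2, the kernel contains u because phi_{q+1} squares to zero
    ([phiC]), while a conjugate boson mode maps the image of w to -1/c times that of v
    ([w_pr_phi_vac_neq0]).

    The free field modules are built explicitly: [fock_fields] gives the modes, [Gop] is the
    bilinear supercurrent, L(n) is defined as an anticommutator, and the relations follow from
    [super_commute_eq0], with the central term computed in [Ganti_diag]. *)

(** * Deciding identities between linear combinations *)

Section LinearCombinations.
Variables (K : pzRingType) (M : lmodType K).

Inductive lexp :=
  | LVar of nat | LZero | LAdd of lexp & lexp | LOpp of lexp | LScale of K & lexp.

Fixpoint leval (env : seq M) (x : lexp) : M :=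
  match x with
  | LVar i => nth 0 env i
  | LZero => 0
  | LAdd y z => leval env y + leval env z
  | LOpp y => - leval env y
  | LScale a y => a *: leval env y
  end.

Fixpoint lcoef (x : lexp) (i : nat) : K :=
  match x with
  | LVar j => (i == j)%:R
  | LZero => 0
  | LAdd y z => lcoef y i + lcoef z i
  | LOpp y => - lcoef y i
  | LScale a y => a * lcoef y i
  end.

Lemma leval_sum env x : leval env x = \sum_(i < size env) lcoef x i *: nth 0 env i.
Proof.
elim: x => /= [j||y -> z ->|y ->|a y ->].
- have [jn|nj] := ltnP j (size env).
    rewrite (bigD1 (Ordinal jn)) //= eqxx scale1r big1 ?addr0 // => i.
    by rewrite -val_eqE /= => /negPf->; rewrite scale0r.
  rewrite nth_default // big1 // => i _.
  by rewrite ltn_eqF ?scale0r // (leq_trans (ltn_ord i)).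
- by rewrite big1 // => i _; rewrite scale0r.
- by rewrite -big_split; apply: eq_bigr => i _; rewrite scalerDl.
- by rewrite -sumrN; apply: eq_bigr => i _; rewrite scaleNr.
- by rewrite scaler_sumr; apply: eq_bigr => i _; rewrite scalerA.
Qed.

Fixpoint eq_coefs (n : nat) (x y : lexp) : Prop :=
  if n is n'.+1 then lcoef x n' = lcoef y n' /\ eq_coefs n' x y else True.

(** Comparing coefficients atom by atom suffices, whether or not the atoms are independent; what
    remains are scalar identities for [ring] or [field]. *)
Lemma leval_eq env x y : eq_coefs (size env) x y -> leval env x = leval env y.
Proof.
move=> h; rewrite !leval_sum; apply: eq_bigr => -[i /= + _].
elim: (size env) h => //= n IHn [e /IHn {}IHn].
by rewrite ltnS leq_eqVlt => /predU1P[->|/IHn//]; rewrite e.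
Qed.

End LinearCombinations.

(* Atoms are compared up to conversion: the lemmas on linear maps leave          *)
(* convertible but syntactically different coercions.                            *)
Ltac index_of u env :=
  lazymatch env with
  | cons ?v ?env' =>
    match constr:(Set) with
    | _ => let _ := match constr:(Set) with _ => unify u v end in constr:(0%N)
    | _ => let i := index_of u env' in constr:(S i)
    end
  end.

Ltac add_atom u env :=
  lazymatch env with
  | nil => constr:(cons u nil)
  | cons ?v ?env' =>
    match constr:(Set) with
    | _ => let _ := match constr:(Set) with _ => unify u v end in constr:(env)
    | _ => let env'' := add_atom u env' in constr:(cons v env'')
    end
  end.

Ltac atoms t env :=
  lazymatch t with
  | ?a + ?b => let env := atoms a env in atoms b env
  | - ?a => atoms a env
  | ?k *: ?a => atoms a env
  | 0 => env
  | _ => add_atom t env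
  end.

Ltac reify K t env :=
  lazymatch t with
  | ?a + ?b => let x := reify K a env in let y := reify K b env in
               constr:(@LAdd K x y)
  | - ?a => let x := reify K a env in constr:(@LOpp K x)
  | ?k *: ?a => let x := reify K a env in constr:(@LScale K k x)
  | 0 => constr:(@LZero K)
  | _ => let i := index_of t env in constr:(@LVar K i)
  end.

Ltac lmod_with K M :=
  lazymatch goal with
  | |- ?a = ?b =>
    let env := atoms a (@nil M) in
    let env := atoms b env in
    let x := reify K a env in
    let y := reify K b env in
    apply: (@leval_eq K M env x y);
    rewrite /=; repeat split
  end.

(** * Finite truncations of sums over the integers, and linearity of plain functions *)

Definition window (N : nat) : seq int := [seq i%:Z - N%:Z | i <- iota 0 (N + N)].

Lemma window_uniq N : uniq (window N).
Proof.
rewrite map_inj_uniq ?iota_uniq // => i j.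
by move/addIr => [].
Qed.

Lemma mem_window N k : (k \in window N) = (- N%:Z <= k < N%:Z).
Proof.
apply/mapP/idP => [|kN]; first by case=> i; rewrite mem_iota => ? ->; lia.
exists (absz (k + N%:Z)); last by lia.
by rewrite mem_iota; lia.
Qed.

Lemma fsbig_support (I : choiceType) (M : nmodType) (t : I -> M) (r : seq I) :
  uniq r -> (forall k, k \notin r -> t k = 0) ->
  \sum_(k \in [set: I]) t k = \sum_(k <- r) t k.
Proof.
move=> ur tr; rewrite (fsbig_seq _ _ ur); apply/esym/fsbig_widen => //.
by move=> k [_ /= /negP]; exact: tr.
Qed.

Lemma sum_window1 (M : nmodType) (t : int -> M) N k0 : k0 \in window N ->
  \sum_(k <- window N | k == k0) t k = t k0.
Proof. by move=> kN; rewrite -big_filter filter_pred1_uniq ?window_uniq // big_seq1. Qed.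

Section LinearMaps.
Variables (K : pzRingType) (M N : lmodType K) (f : M -> N).
Hypothesis fL : linear f.
Let f' := HB.pack_for {linear M -> N} f (GRing.isLinear.Build K M N *:%R f fL).

Lemma lin0 : f 0 = 0. Proof. exact: (linear0 f'). Qed.
Lemma linD u v : f (u + v) = f u + f v. Proof. exact: (linearD f'). Qed.
Lemma linN u : f (- u) = - f u. Proof. exact: (linearN f'). Qed.
Lemma linZ a u : f (a *: u) = a *: f u. Proof. exact: (linearZ_LR f'). Qed.
Lemma lin_sum (I : Type) (r : seq I) (P : pred I) (F : I -> M) :
  f (\sum_(i <- r | P i) F i) = \sum_(i <- r | P i) f (F i).
Proof. exact: (linear_sum f'). Qed.
End LinearMaps.

(** Both sides run over the pairs [i.+1], [j.+1] of positive integers with sum at most k. *)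
Lemma sum_triangle (M : nmodType) (k : nat) (F : nat -> nat -> M) :
  \sum_(i < k) \sum_(j < k - i.+1) F i j = \sum_(j < k) \sum_(i < k - j.+1) F i j.
Proof.
have E (G : nat -> nat -> M) : \sum_(i < k) \sum_(j < k - i.+1) G i j =
    \sum_(i < k) \sum_(j < k | (i + j < k.-1)%N) G i j.
  apply: eq_bigr => i _; rewrite (big_ord_widen k) ?leq_subr //.
  by apply: eq_bigl => j; have := ltn_ord i; lia.
rewrite E (E (fun i j => F j i)) (exchange_big_dep xpredT) //=.
by apply: eq_bigr => j _; apply: eq_bigl => i; rewrite addnC.
Qed.

(** * Schur polynomials in commuting operators *)

Section Schur.
Variables (R : realType) (V : SHmodule R) (b : nat -> V -> V).
Hypothesis bL : forall n, linear (b n).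
Hypothesis bC : forall m n u, b m (b n u) = b n (b m u).
Local Notation S := (schur b).
Local Ltac lm := lmod_with (R[i] : pzRingType) (SHcarrier V).

(** The coefficients of B(z)^m u, where B(z) is the sum of the b_n z^n/n. *)
Let pw m u := iter m (series_op b) (fun j => if j == 0%N then u else 0).

Let pwS m u k : pw m.+1 u k = \sum_(i < k) i.+1%:R^-1 *: b i.+1 (pw m u (k - i.+1)).
Proof.
by rewrite /pw iterS {1}/series_op big_add1 /= big_mkord.
Qed.

Let pw_small m u k : (k < m)%N -> pw m u k = 0.
Proof.
elim: m k => // m IHm k km; rewrite pwS big1 // => i _.
by rewrite IHm ?(lin0 (bL _)) ?scaler0 //; have := ltn_ord i; lia.
Qed.

(** Since the b_n commute, z d/dz maps B^(m+1) to (m+1)(zB')B^m; the induction is the Leibniz rule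
    for B times B^(m+1). *)
Let pw_euler m u k : k%:R *: pw m.+1 u k =
  m.+1%:R *: \sum_(i < k) b i.+1 (pw m u (k - i.+1)).
Proof.
elim: m k => [|m IHm] k.
  rewrite pwS scaler_sumr scale1r; apply: eq_bigr => i _.
  have [ik|ik] := eqVneq (k - i.+1)%N 0%N; last first.
    by rewrite /pw /= (negPf ik) (lin0 (bL _)) !scaler0.
  have {1}-> : k = i.+1 by have := ltn_ord i; lia.
  by rewrite scalerA divff ?scale1r // pnatr_eq0.
rewrite pwS scaler_sumr.
transitivity (\sum_(i < k) b i.+1 (pw m.+1 u (k - i.+1)) + m.+1%:R *:
    \sum_(i < k) \sum_(j < k - i.+1)
      i.+1%:R^-1 *: b i.+1 (b j.+1 (pw m u (k - i.+1 - j.+1)))).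
  rewrite scaler_sumr -big_split; apply: eq_bigr => i _ /=.
  have -> : \sum_(j < k - i.+1) i.+1%:R^-1 *: b i.+1 (b j.+1 (pw m u (k - i.+1 - j.+1)))
      = i.+1%:R^-1 *: b i.+1 (\sum_(j < k - i.+1) b j.+1 (pw m u (k - i.+1 - j.+1))).
    by rewrite (lin_sum (bL _)) scaler_sumr.
  have -> : m.+1%:R *: (i.+1%:R^-1 *:
        b i.+1 (\sum_(j < k - i.+1) b j.+1 (pw m u (k - i.+1 - j.+1))))
      = i.+1%:R^-1 *: ((k - i.+1)%:R *: b i.+1 (pw m.+1 u (k - i.+1))).
    by rewrite -(linZ (bL _)) IHm (linZ (bL _)); lm; ring.
  have {1}-> : k = (k - i.+1 + i.+1)%N by rewrite subnK.
  by rewrite natrD; lm; field; rewrite nat1r pnatr_eq0.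
have -> : \sum_(i < k) \sum_(j < k - i.+1)
    i.+1%:R^-1 *: b i.+1 (b j.+1 (pw m u (k - i.+1 - j.+1))) =
  \sum_(j < k) b j.+1 (pw m.+1 u (k - j.+1)).
  etransitivity; first exact: (sum_triangle k (fun i j =>
    i.+1%:R^-1 *: b i.+1 (b j.+1 (pw m u (k - i.+1 - j.+1))))).
  apply: eq_bigr => j _; rewrite pwS (lin_sum (bL _)); apply: eq_bigr => i _.
  by rewrite (linZ (bL _)) bC subnAC.
by rewrite -[m.+2]addn1 natrD; lm; ring.
Qed.

Lemma schur0 u : S 0 u = u.
Proof. by rewrite /schur big_ord1 fact0 invr1 scale1r. Qed.

Let schurE k u : S k u = \sum_(m < k.+1) (m`!)%:R^-1 *: pw m u k.
Proof. by []. Qed.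

(** This is z d/dz exp(B) = (zB') exp(B). As k > 0 is invertible, it determines S_k by induction and
    replaces the sum over powers from here on. *)
Lemma schur_rec k u : k%:R *: S k u = \sum_(i < k) b i.+1 (S (k - i.+1) u).
Proof.
rewrite schurE scaler_sumr big_ord_recl.
transitivity (\sum_(m < k) \sum_(i < k) (m`!)%:R^-1 *: b i.+1 (pw m u (k - i.+1))).
  rewrite (_ : k%:R *: _ = 0) ?add0r.
    apply: eq_bigr => m _; rewrite scalerA mulrC -scalerA pw_euler scalerA.
    rewrite -scaler_sumr; congr (_ *: _); rewrite lift0 factS natrM.
    by rewrite invfM mulrAC mulVf ?mul1r // pnatr_eq0.
  by case: k => [|k]; rewrite /pw /= ?scale0r ?scaler0.
rewrite exchange_big /=; apply: eq_bigr => i _.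
rewrite schurE (lin_sum (bL _)) (big_ord_widen k (fun m =>
  b i.+1 ((m`!)%:R^-1 *: pw m u (k - i.+1)))); last first.
  by have := ltn_ord i; lia.
rewrite [RHS]big_mkcond; apply: eq_bigr => m _; rewrite (linZ (bL _)).
case: ltnP => // km; by rewrite pw_small ?(lin0 (bL _)) ?scaler0.
Qed.

Lemma schur_linear k : linear (S k).
Proof.
elim/ltn_ind: k => -[|k] IHk a u v; first by rewrite !schur0.
have k0 : k.+1%:R != 0 :> R[i] by rewrite pnatr_eq0.
apply: (scalerI k0); rewrite scalerDr scalerA mulrC -scalerA !schur_rec.
rewrite scaler_sumr -big_split; apply: eq_bigr => i _ /=.
by rewrite IHk ?bL //; lia.
Qed.

(** The hypotheses say that [T, B(z)] is the series g(z) of the g_i z^i, the factor i cancelling the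
    1/i in B, and that g commutes with B; hence [T, exp(B)] = g exp(B). *)
Lemma schur_derivation (T : V -> V) (g : nat -> V -> V) :
  linear T -> (forall i, linear (g i)) -> (forall i j u, g i (b j u) = b j (g i u)) ->
  (forall i u, T (b i u) = b i (T u) + i%:R *: g i u) ->
  forall k u, T (S k u) = S k (T u) + \sum_(i < k) g i.+1 (S (k - i.+1) u).
Proof.
move=> TL gL gb Tb; elim/ltn_ind => -[|k] IHk u.
  by rewrite !schur0 big_ord0 addr0.
have k0 : k.+1%:R != 0 :> R[i] by rewrite pnatr_eq0.
apply: (scalerI k0); rewrite -(linZ TL) schur_rec (lin_sum TL) scalerDr schur_rec.
transitivity (\sum_(i < k.+1) b i.+1 (S (k.+1 - i.+1) (T u)) +
  \sum_(i < k.+1) \sum_(j < k.+1 - i.+1) b i.+1 (g j.+1 (S (k.+1 - i.+1 - j.+1) u)) +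
  \sum_(i < k.+1) i.+1%:R *: g i.+1 (S (k.+1 - i.+1) u)).
  rewrite -!big_split; apply: eq_bigr => i _ /=.
  by rewrite Tb IHk ?(linD (bL _)) ?(lin_sum (bL _)) //; lia.
rewrite -addrA; congr (_ + _).
have -> : \sum_(i < k.+1) \sum_(j < k.+1 - i.+1) b i.+1 (g j.+1 (S (k.+1 - i.+1 - j.+1) u)) =
    \sum_(j < k.+1) (k.+1 - j.+1)%:R *: g j.+1 (S (k.+1 - j.+1) u).
  etransitivity; first exact: (sum_triangle k.+1
    (fun i j => b i.+1 (g j.+1 (S (k.+1 - i.+1 - j.+1) u)))).
  apply: eq_bigr => j _; rewrite -(linZ (gL _)) schur_rec (lin_sum (gL _)).
  by apply: eq_bigr => i _; rewrite gb subnAC.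
rewrite -big_split scaler_sumr; apply: eq_bigr => i _ /=.
by rewrite -scalerDl -natrD subnK.
Qed.

Lemma schur_comm (T : V -> V) : linear T -> (forall i u, T (b i u) = b i (T u)) ->
  forall k u, T (S k u) = S k (T u).
Proof.
move=> TL Tb k u; rewrite (@schur_derivation T (fun _ _ => 0)) //.
- by rewrite big1 ?addr0.
- by move=> i a v w; rewrite scaler0 addr0.
- by move=> i j v; rewrite (lin0 (bL _)).
- by move=> i v; rewrite scaler0 addr0.
Qed.

Lemma schur_letter i k u : b i (S k u) = S k (b i u).
Proof. exact: (schur_comm (bL i)). Qed.

Lemma schurC k l u : S k (S l u) = S l (S k u).
Proof.
by apply: schur_comm => [|i v]; [exact: schur_linear|rewrite schur_letter].
Qed.

End Schur.

Section SchurProduct.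
Variables (R : realType) (V : SHmodule R) (b b' : nat -> V -> V).
Hypothesis bL : forall n, linear (b n).
Hypothesis bC : forall m n u, b m (b n u) = b n (b m u).
Hypothesis b'E : forall n u, b' n u = 2%:R *: b n u.
Local Notation S := (schur b).
Local Ltac lm := lmod_with (R[i] : pzRingType) (SHcarrier V).

(** This is exp(2B) = exp(B)^2: both sides satisfy the recursion [schur_rec] for 2B. *)
Lemma schur_double n u : schur b' n u = \sum_(i < n.+1) S i (S (n - i) u).
Proof.
have b'L k : linear (b' k) by move=> a x y; rewrite !b'E bL; lm; ring.
have b'C k l x : b' k (b' l x) = b' l (b' k x).
  by rewrite !b'E !(linZ (bL _)) bC.
elim/ltn_ind: n => -[|n] IHn; first by rewrite big_ord1 !schur0.
have n0 : n.+1%:R != 0 :> R[i] by rewrite pnatr_eq0.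
apply: (scalerI n0); rewrite schur_rec //.
pose P m := \sum_(i < m.+1) S i (S (m - i) u).
(* The degree n+1 splits as i + (n+1-i), and the two halves agree under the reflection of i. *)
have rev : \sum_(i < n.+2) i%:R *: S i (S (n.+1 - i) u) =
    \sum_(i < n.+2) (n.+1 - i)%:R *: S i (S (n.+1 - i) u).
  rewrite (reindex_inj rev_ord_inj) /=; apply: eq_bigr => i _.
  rewrite subSS schurC //; congr (_ *: S _ (S _ _)).
  by rewrite subKn // -ltnS.
have half : \sum_(i < n.+2) (n.+1 - i)%:R *: S i (S (n.+1 - i) u) =
    \sum_(i < n.+1) b i.+1 (P (n.+1 - i.+1)%N).
  transitivity (\sum_(j < n.+2) \sum_(i < n.+2 - j.+1) b i.+1 (S j (S (n.+1 - j - i.+1) u))).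
    apply: eq_bigr => j _; rewrite -(linZ (schur_linear bL bC _)) schur_rec //.
    rewrite (lin_sum (schur_linear bL bC _)); apply: eq_bigr => i _.
    by apply/esym/schur_letter.
  rewrite (sum_triangle n.+2 (fun j i => b i.+1 (S j (S (n.+1 - j - i.+1) u)))).
  rewrite big_ord_recr /= subnn big_ord0 addr0; apply: eq_bigr => i _.
  have -> : (n.+2 - i.+1 = (n.+1 - i.+1).+1)%N by have := ltn_ord i; lia.
  rewrite (lin_sum (bL _)).
  by apply: eq_bigr => j _; rewrite subnAC.
transitivity (2%:R *: \sum_(i < n.+1) b i.+1 (P (n.+1 - i.+1)%N)).
  rewrite scaler_sumr; apply: eq_bigr => i _; rewrite b'E IHn //; lia.
rewrite -half scalerDl !scale1r -{1}rev -big_split scaler_sumr.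
apply: eq_bigr => i _ /=; rewrite -scalerDl -natrD subnKC //; by rewrite -ltnS.
Qed.
End SchurProduct.

(** * Singular and subsingular vectors *)

Section SuperHeisenberg.
Variables (R : realType) (V : SHmodule R) (cL c : R[i]).
Hypothesis (chV : has_charges V cL c) (c0 : c != 0).
Implicit Types (u v : V) (m n : int) (i j k l : nat).
Local Notation al n := (act V (SH_alpha n)).
Local Notation ps n := (act V (SH_Psi n)).
Local Notation G n := (act V (SH_G n)).
Local Notation L n := (act V (SH_L n)).
Local Notation E := (schur (beta c 2%:R)).
Local Ltac lm := lmod_with (R[i] : pzRingType) (SHcarrier V).

Let actD x u v : act V x (u + v) = act V x u + act V x v.
Proof. exact: linearD. Qed.
Let actN x u : act V x (- u) = - act V x u.
Proof. exact: linearN. Qed.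
Let actZ x a u : act V x (a *: u) = a *: act V x u.
Proof. exact: linearZ_LR. Qed.
Let act_lin x : linear (act V x).
Proof. exact: linearP. Qed.

Lemma alphaC m n u : al m (al n u) = al n (al m u).
Proof.
have := @SH_alpha_alpha _ V m n u; rewrite /comm; have [_ -> _] := chV u.
by rewrite scaler0 => /subr0_eq.
Qed.

Lemma alpha_Psi m n u : al m (ps n u) = ps n (al m u).
Proof. by have := @SH_alpha_Psi _ V m n u; rewrite /comm => /subr0_eq. Qed.

Lemma PsiC m n u : ps m (ps n u) = - ps n (ps m u).
Proof.
have := @SH_Psi_Psi _ V m n u; rewrite /acomm; have [_ -> _] := chV u.
by rewrite scaler0 => /eqP; rewrite addr_eq0 => /eqP.
Qed.

Lemma G_alpha n m u : G n (al m u) = al m (G n u) - m%:~R *: ps (m + n) u.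
Proof. by rewrite -SH_alpha_G /comm opprB addrC subrK. Qed.

Lemma G_Psi n m u : G n (ps m u) = - ps m (G n u) + al (m + n + 1) u
  + ((m + n + 1 == 0)%:R * (2%:Z * m)%:~R * c) *: u.
Proof.
have := @SH_Psi_G _ V m n u; rewrite /acomm; have [_ _ ->] := chV u.
by rewrite scalerA => H; rewrite -addrA -H addrA addNr add0r.
Qed.

Lemma L0_alpha n u : L 0 (al n u) = al n (L 0 u) - n%:~R *: al n u.
Proof.
have := @SH_L_alpha _ V 0 n u; rewrite /comm expr0n addr0 mulr0 scale0r subr0 add0r.
by move/(canRL (subrK _)); rewrite addrC.
Qed.

Lemma L0_Psi n u : L 0 (ps n u) = ps n (L 0 u) - ((2%:Z * n + 1)%:~R / 2%:R) *: ps n u.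
Proof.
have := @SH_Psi_L _ V n 0 u; rewrite /comm addr0 addr0 => <-.
by rewrite opprB addrC subrK.
Qed.

Lemma G0_G n u : 2%:R *: L (n + 1) u = G 0 (G n u) + G n (G 0 u).
Proof.
by have := @SH_G_G _ V 0 n u; rewrite /acomm expr0n addr0 mul0r mulr0 scale0r addr0 add0r.
Qed.

Let betaL t k : linear (@beta _ V c t k).
Proof. by move=> a u v; rewrite /beta actD actZ; lm; ring. Qed.

Let betaC t k l u : beta c t k (beta c t l u) = beta c t l (beta c t k u).
Proof. by rewrite /beta !actZ alphaC; lm; ring. Qed.

Lemma schur_beta_linear k : linear (E k : V -> V).
Proof. exact: schur_linear (betaL _) (betaC _) k. Qed.

Lemma schur_beta (T : V -> V) : linear T -> (forall n u, T (al n u) = al n (T u)) ->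
  forall k u, T (E k u) = E k (T u).
Proof.
move=> TL Tal; apply: (schur_comm (betaL _) (betaC _) TL) => i u.
by rewrite /beta (linZ TL) Tal.
Qed.

Let al_E n k u : al n (E k u) = E k (al n u).
Proof. by apply: (schur_beta (act_lin _)) => m v; exact: alphaC. Qed.

Let ps_E n k u : ps n (E k u) = E k (ps n u).
Proof. by apply: (schur_beta (act_lin _)) => m v; rewrite alpha_Psi. Qed.

Let E_rec k u : k%:R *: E k u = \sum_(i < k) beta c 2%:R i.+1 (E (k - i.+1) u).
Proof. exact: schur_rec (betaL _) (betaC _) k u. Qed.

(* The coefficient of z^(k-1) in Psi(z) E(z) u when Psi(s) u = 0 for s > 0.      *)
Definition phi k u : V := \sum_(l < k) ps (- l%:Z - 1) (E (k - l.+1) u).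

Lemma phi_linear k : linear (phi k).
Proof.
move=> a u v; rewrite /phi scaler_sumr -big_split; apply: eq_bigr => l _.
by rewrite schur_beta_linear actD actZ.
Qed.

Let al_phi n k u : al n (phi k u) = phi k (al n u).
Proof.
by rewrite /phi linear_sum; apply: eq_bigr => l _; rewrite alpha_Psi al_E.
Qed.

Let ps_phi n k u : ps n (phi k u) = - phi k (ps n u).
Proof.
rewrite /phi linear_sum -sumrN; apply: eq_bigr => l _.
by rewrite PsiC ps_E.
Qed.

Let E_phi j k u : phi k (E j u) = E j (phi k u).
Proof. by apply: (schur_beta (phi_linear k)) => n v; rewrite al_phi. Qed.

Lemma phiC j k u : phi j (phi k u) = - phi k (phi j u).
Proof.
rewrite {1 4}/phi (lin_sum (phi_linear k)) -sumrN; apply: eq_bigr => l _.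
by rewrite -E_phi ps_phi.
Qed.

Lemma L0_E k u : L 0 (E k u) = E k (L 0 u) + k%:R *: E k u.
Proof.
rewrite E_rec; apply: (schur_derivation (betaL _) (betaC _) (act_lin _)).
- exact: betaL.
- by move=> i j v; exact: betaC.
- move=> i v; rewrite /beta actZ L0_alpha; lm; rewrite ?rmorphN /=; ring.
Qed.

Lemma L0_phi k u : L 0 (phi k u) = phi k (L 0 u) + (k%:R - 2%:R^-1) *: phi k u.
Proof.
rewrite /phi linear_sum scaler_sumr -big_split; apply: eq_bigr => l _ /=.
rewrite L0_Psi L0_E actD actZ natrB //.
by lm; rewrite ?(rmorphD, rmorphN, rmorphM) /= -?[l.+1]addn1 ?natrD; field.
Qed.

(** The part of the highest weight condition that E and [phi] preserve, so that the commutation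
    formulas for G can be iterated. *)
Definition alphaPsi_vacuum (p : R[i]) u : Prop :=
  [/\ forall n, 0 < n -> al n u = 0, al 0 u = ((1 + p) * c) *: u &
      forall n, 0 <= n -> ps n u = 0].

Lemma alphaPsi_vacuum_E p k u : alphaPsi_vacuum p u -> alphaPsi_vacuum p (E k u).
Proof.
case=> a1 a0 p0; split=> [n n0||n n0]; rewrite ?al_E ?ps_E.
- by rewrite a1 // (lin0 (schur_beta_linear _)).
- by rewrite a0 (linZ (schur_beta_linear _)).
- by rewrite p0 // (lin0 (schur_beta_linear _)).
Qed.

Lemma alphaPsi_vacuum_phi p k u : alphaPsi_vacuum p u -> alphaPsi_vacuum p (phi k u).
Proof.
case=> a1 a0 p0; split=> [n n0||n n0]; rewrite ?al_phi ?ps_phi.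
- by rewrite a1 // (lin0 (phi_linear _)).
- by rewrite a0 (linZ (phi_linear _)).
- by rewrite p0 // (lin0 (phi_linear _)) oppr0.
Qed.

(** [G(m+1/2), beta(-i)] = -(i/(2c)) Psi(m-i+1/2), so [schur_derivation] applies. The modes with i
    <= m kill u and the others assemble into [phi]. *)
Lemma G_E p (m : nat) k u : alphaPsi_vacuum p u ->
  G m%:Z (E k u) = E k (G m%:Z u) - (2%:R * c)^-1 *: phi (k - m) u.
Proof.
case=> a1 a0 p0.
pose g i v := - (2%:R * c)^-1 *: ps (m%:Z - i%:Z) v.
rewrite (@schur_derivation _ _ _ (betaL _) (betaC _) _ g (act_lin _)).
- congr (_ + _); rewrite /g -scaler_sumr scaleNr; congr (- (_ *: _)).
  have z i : (i < m)%N -> ps (m%:Z - i.+1%:Z) (E (k - i.+1) u) = 0.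
    by move=> im; rewrite ps_E p0 ?(lin0 (schur_beta_linear _)) //; lia.
  rewrite -(big_mkord xpredT (fun i => ps (m%:Z - i.+1%:Z) (E (k - i.+1) u))).
  have [mk|km] := leqP m k.
    rewrite (big_cat_nat _ mk) //= big_nat big1 ?add0r => [|i im]; last by rewrite z.
    rewrite -{1}[m]add0n big_addn big_mkord; apply: eq_bigr => l _.
    by congr (act V (SH_Psi _) (E _ _)); lia.
  rewrite (_ : (k - m = 0)%N) ?/phi ?big_ord0; last by lia.
  by rewrite big_nat big1 // => i ik; rewrite z //; lia.
- by move=> i a x y; rewrite /g actD actZ; lm; ring.
- by move=> i j v; rewrite /g /beta !actZ alpha_Psi; lm; ring.
- move=> i v; rewrite /g /beta actZ G_alpha.
  rewrite (_ : - i%:Z + m%:Z = m%:Z - i%:Z); last by lia.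
  by lm; rewrite ?rmorphN /=; ring.
Qed.

Lemma sum_antisym K (F : nat -> nat -> V) : (forall i j, F i j = - F j i) ->
  \sum_(i < K) \sum_(j < K - i.+1) F i j = 0.
Proof.
move=> FN; set X := (X in X = _).
have XN : X = - X.
  rewrite {1}/X sum_triangle /X -sumrN; apply: eq_bigr => i _.
  by rewrite -sumrN; apply: eq_bigr => j _.
have /eqP : 2%:R *: X = 0 by rewrite scaler_nat mulr2n {1}XN addNr.
by rewrite scaler_eq0 pnatr_eq0 /= => /eqP.
Qed.

(** The terms with two fermions cancel by antisymmetry. Then alpha(0) gives (1+p)c, the negative
    alpha modes give -2c(k-m-1) by the Schur recursion, and the central term gives -2c(m+1): m drops
    out of the total. *)
Lemma G_phi p (m : nat) k u : alphaPsi_vacuum p u -> G m%:Z (phi k u) = - phi k (G m%:Z u)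
  + (if (m < k)%N then ((1 + p - 2%:R * k%:R) * c) *: E (k - m.+1) u else 0).
Proof.
move=> gu; have [a1 a0 p0] := gu.
rewrite {1}/phi linear_sum.
transitivity (\sum_(l < k) (- ps (- l%:Z - 1) (E (k - l.+1) (G m%:Z u))
  + (2%:R * c)^-1 *: ps (- l%:Z - 1) (phi (k - l.+1 - m) u)
  + (al (m%:Z - l%:Z) (E (k - l.+1) u)
     - ((m == l)%:R * (2%:R * l.+1%:R) * c) *: E (k - l.+1) u))).
  apply: eq_bigr => l _; rewrite G_Psi (G_E _ _ gu) actD actN actZ.
  rewrite (_ : - l%:Z - 1 + m%:Z + 1 = m%:Z - l%:Z); last by lia.
  rewrite subr_eq0 eqz_nat.
  by lm; rewrite ?(rmorphD, rmorphN, rmorphM) /= -?[l.+1]addn1 ?natrD; ring.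
rewrite !big_split /= sumrN -scaler_sumr -addrA; congr (_ + _).
have -> : \sum_(l < k) ps (- l%:Z - 1) (phi (k - l.+1 - m) u) = 0.
  pose F i j := ps (- i%:Z - 1) (ps (- j%:Z - 1) (E (k - m - i.+1 - j.+1) u)).
  have FN i j : F i j = - F j i by rewrite /F PsiC subnAC.
  rewrite -[RHS](sum_antisym (k - m) FN).
  rewrite (big_ord_widen k (fun i => \sum_(j < k - m - i.+1) F i j)) ?leq_subr //.
  rewrite [RHS]big_mkcond; apply: eq_bigr => l _.
  rewrite /phi (lin_sum (act_lin _)) subnAC.
  by case: ltnP => // kl; rewrite (_ : (k - m - l.+1 = 0)%N) ?big_ord0 //; lia.
rewrite scaler0 add0r.
have [mk|km] := ltnP m k; last first.
  rewrite !big1 ?addr0 // => l _.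
    by rewrite gtn_eqF ?mul0r ?mul0r ?scale0r ?oppr0 //; have := ltn_ord l; lia.
  by rewrite al_E a1 ?(lin0 (schur_beta_linear _)) //; have := ltn_ord l; lia.
have -> : \sum_(l < k) - (((m == l)%:R * (2%:R * l.+1%:R) * c) *: E (k - l.+1) u)
   = - ((2%:R * m.+1%:R * c) *: E (k - m.+1) u).
  rewrite sumrN (bigD1 (Ordinal mk)) //= eqxx mul1r big1 ?addr0 // => l.
  by rewrite -val_eqE /= eq_sym => /negPf->; rewrite !mul0r scale0r.
have -> : \sum_(l < k) al (m%:Z - l%:Z) (E (k - l.+1) u) =
   ((1 + p) * c) *: E (k - m.+1) u - (2%:R * c * (k - m.+1)%:R) *: E (k - m.+1) u.
  rewrite -(big_mkord xpredT (fun l => al (m%:Z - l%:Z) (E (k - l.+1) u))).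
  rewrite (@big_cat_nat _ _ _ m.+1) //= big_nat_recr //= subrr al_E a0.
  rewrite (linZ (schur_beta_linear _)).
  rewrite big_nat big1 ?add0r => [|l lm]; last first.
    by rewrite al_E a1 ?(lin0 (schur_beta_linear _)) //; lia.
  congr (_ + _); rewrite -{1}[m.+1]add0n big_addn big_mkord.
  rewrite -scalerA E_rec -scaleNr scaler_sumr; apply: eq_bigr => l _.
  rewrite /beta scalerA mulrNN divff ?scale1r ?mulf_neq0 ?pnatr_eq0 //.
  by congr (act V (SH_alpha _) (E _ _)); lia.
rewrite natrB //.
by lm; ring.
Qed.

Lemma Psi_S_phi q (k : int) K u : alphaPsi_vacuum q u -> forall p : nat,
  k - (p.+1)./2%:Z = - K%:Z -> Psi_S c p k u = phi K u.
Proof.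
case=> _ _ p0 p kK; rewrite /Psi_S (@fsbig_support _ _ _ (index_iota 0 K)) ?iota_uniq //.
  rewrite big_mkord (reindex_inj rev_ord_inj) /=; apply: eq_bigr => l _.
  by congr (act V (SH_Psi _) (E _ _)); have := ltn_ord l; lia.
move=> i; rewrite mem_index_iota -leqNgt => Ki.
by rewrite ps_E p0 ?(lin0 (schur_beta_linear _)) //; lia.
Qed.

Section Singular.
Variables (q : nat) (v : V).
Let p := (q.*2.+1)%N.
Hypothesis gv : alphaPsi_vacuum p%:R v.

Lemma w_pr_phi : w_pr c p v = \sum_(i < p.+1) E i (E (p - i) v)
  + \sum_(k < q) (2%:R * c ^+ 2 * k.+1%:R)^-1 *: phi (q - k) (phi (q.+2 + k) v).
Proof.
rewrite /w_pr (schur_double (betaL 2%:R) (betaC 2%:R)); last first.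
  by move=> n u; rewrite /beta scalerA mul1r; congr (_ *: _); field.
congr (_ + _).
rewrite /p /= doubleK big_add1 /= big_mkord; apply: eq_bigr => k _.
have hp : ((q.*2.+2)./2 = q.+1)%N by rewrite -doubleS doubleK.
rewrite (@Psi_S_phi p%:R (- k.+1%:Z) (q.+2 + k)) //; last by rewrite hp; lia.
rewrite (@Psi_S_phi p%:R _ (q - k)) //; first exact: alphaPsi_vacuum_phi.
by rewrite hp; have := ltn_ord k; lia.
Qed.

Hypothesis Gv : forall m : nat, G m%:Z v = 0.

Lemma G_phi_singular (m : nat) : G m%:Z (phi q.+1 v) = 0.
Proof.
rewrite (G_phi _ _ gv) Gv (lin0 (phi_linear _)) oppr0 add0r.
case: ifP => // _; rewrite (_ : _ * c = 0) ?scale0r //.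
by rewrite /p -addn1 -muln2 natrD natrM -[q.+1]addn1 natrD; ring.
Qed.

(* G(m+1/2) w is a sum of terms X m t, in which only t = q+1 does not cancel.    *)
Let X (m t : nat) := if (t + m <= p)%N then E (p - m - t) (phi t v) else 0.

Let phi0 u : phi 0 u = 0.
Proof. by rewrite /phi big_ord0. Qed.

(** The term t = 0 vanishes, and the rest are paired symmetrically about t = q+1. *)
Let sum_X (m : nat) : \sum_(t < p.+1) X m t =
  X m q.+1 + \sum_(k < q) (X m (q - k) + X m (q.+2 + k)).
Proof.
rewrite -(big_mkord xpredT) (@big_cat_nat _ _ _ q.+1) //=; last by rewrite /p; lia.
rewrite big_split /= big_mkord big_ord_recl {1}/X phi0 (lin0 (schur_beta_linear _)).
rewrite if_same add0r.
rewrite (reindex_inj rev_ord_inj) /= big_ltn; last by rewrite /p; lia.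
rewrite addrCA; congr (_ + (_ + _)).
  by apply: eq_bigr => k _; congr X; rewrite /bump /=; have := ltn_ord k; lia.
rewrite -{1}[q.+2]add0n big_addn big_mkord.
rewrite (_ : (p.+1 - q.+2 = q)%N); last by rewrite /p; lia.
by apply: eq_bigr => k _; rewrite addnC.
Qed.

Let G_schur_part (m : nat) : G m%:Z (\sum_(i < p.+1) E i (E (p - i) v)) =
  - c^-1 *: \sum_(t < p.+1) X m t.
Proof.
transitivity (- c^-1 *: \sum_(i < p.+1) E (p - i) (phi (i - m) v)).
  rewrite (lin_sum (act_lin _)).
  transitivity (\sum_(i < p.+1) (- (2%:R * c)^-1 *: E i (phi (p - i - m) v))
    + \sum_(i < p.+1) (- (2%:R * c)^-1 *: E (p - i) (phi (i - m) v))).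
    rewrite -big_split; apply: eq_bigr => i _ /=.
    rewrite (G_E _ _ (alphaPsi_vacuum_E _ gv)) (G_E _ _ gv) Gv.
    rewrite (lin0 (schur_beta_linear _)) sub0r.
    by rewrite (linN (schur_beta_linear _)) (linZ (schur_beta_linear _)) E_phi; lm; ring.
  rewrite (reindex_inj rev_ord_inj) /= -big_split scaler_sumr; apply: eq_bigr => i _ /=.
  rewrite subSS subKn; last by rewrite -ltnS.
  by lm; field.
congr (_ *: _).
have z i : (i <= m)%N -> E (p - i) (phi (i - m) v) = 0.
  by rewrite -subn_eq0 => /eqP->; rewrite phi0 (lin0 (schur_beta_linear _)).
have [mp|pm] := ltnP m p.+1; last first.
  rewrite !big1 // => i _; last by rewrite z //; have := ltn_ord i; lia.
  rewrite /X; case: ifP => // H.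
  rewrite (_ : nat_of_ord i = 0%N) ?phi0 ?(lin0 (schur_beta_linear _)) //.
  lia.
rewrite -(big_mkord xpredT (fun i => E (p - i) (phi (i - m) v))).
rewrite (@big_cat_nat _ _ _ m) //=; last by lia.
rewrite big_nat big1 ?add0r => [|i im]; last by rewrite z //; lia.
rewrite -{1}[m]add0n big_addn big_mkord.
rewrite (big_ord_widen p.+1 (fun i => E (p - (i + m)) (phi (i + m - m) v))) ?leq_subr //.
rewrite big_mkcond; apply: eq_bigr => t _; rewrite /X addnK subnDA subnAC.
have -> : (t < p.+1 - m)%N = (t + m <= p)%N by lia.
by [].
Qed.

(** In the k-th bilinear [G_phi] produces 2(k+1)c from the left factor and -2(k+1)c from the right
    one; the sign from moving G past [phi] makes them agree. The coefficient 1/(2c^2(k+1)) turns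
    both into 1/c, which cancels the k-th pair of [sum_X]. *)
Lemma G_w_pr (m : nat) : G m%:Z (w_pr c p v) =
  if (m <= q)%N then - c^-1 *: E (q - m) (phi q.+1 v) else 0.
Proof.
rewrite w_pr_phi actD G_schur_part sum_X (lin_sum (act_lin _)).
transitivity (- c^-1 *: X m q.+1); last first.
  rewrite /X (_ : (q.+1 + m <= p)%N = (m <= q)%N); last by rewrite /p; lia.
  case: ifP => mq; rewrite ?scaler0 //; congr (_ *: E _ _); rewrite /p; lia.
rewrite scalerDr -addrA scaler_sumr -big_split big1 ?addr0 // => k _ /=.
rewrite actZ (G_phi _ _ (alphaPsi_vacuum_phi _ gv)) (G_phi _ _ gv) Gv.
rewrite (lin0 (phi_linear _)) oppr0 add0r.
have kq := ltn_ord k.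
have -> : (if (m < q.+2 + k)%N
      then ((1 + p%:R - 2%:R * (q.+2 + k)%:R) * c) *: E (q.+2 + k - m.+1) v else 0)
  = - (2%:R * k.+1%:R * c) *: (if (m < q.+2 + k)%N then E (q.+2 + k - m.+1) v else 0).
  case: ifP => // _; last by rewrite scaler0.
  congr (_ *: _); rewrite /p -[q.*2.+1]addn1 -muln2 !natrD natrM.
  rewrite -[q.+2]addn2 -[k.+1]addn1 !natrD; ring.
rewrite (linZ (phi_linear _)).
have -> : (if (m < q - k)%N
      then ((1 + p%:R - 2%:R * (q - k)%:R) * c) *: E (q - k - m.+1) (phi (q.+2 + k) v)
      else 0)
  = (2%:R * k.+1%:R * c) *:
      (if (m < q - k)%N then E (q - k - m.+1) (phi (q.+2 + k) v) else 0).
  case: ifP => // _; last by rewrite scaler0.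
  congr (_ *: _); rewrite /p -[q.*2.+1]addn1 -muln2 natrB ?(ltnW kq) // !natrD natrM.
  rewrite -[k.+1]addn1 !natrD; ring.
have -> : phi (q - k) (if (m < q.+2 + k)%N then E (q.+2 + k - m.+1) v else 0) = X m (q - k).
  rewrite /X (_ : (q - k + m <= p)%N = (m < q.+2 + k)%N); last by rewrite /p; lia.
  case: ifP => H; rewrite ?(lin0 (phi_linear _)) // E_phi; congr (E _ _); rewrite /p; lia.
have -> : (if (m < q - k)%N then E (q - k - m.+1) (phi (q.+2 + k) v) else 0) = X m (q.+2 + k).
  rewrite /X (_ : (q.+2 + k + m <= p)%N = (m < q - k)%N); last by rewrite /p; lia.
  case: ifP => H //; congr (E _ _); rewrite /p; lia.
have k0 : k.+1%:R != 0 :> R[i] by rewrite pnatr_eq0.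
by lm; field; rewrite ?c0 nat1r k0.
Qed.

Lemma L0_w_pr h : L 0 v = h *: v -> L 0 (w_pr c p v) = (h + p%:R) *: w_pr c p v.
Proof.
move=> Lv; rewrite w_pr_phi actD !(lin_sum (act_lin _)) scalerDr !scaler_sumr.
congr (_ + _); apply: eq_bigr => i _.
  rewrite !(L0_E, Lv, linD (schur_beta_linear _), linZ (schur_beta_linear _)).
  rewrite natrB ?leq_ord //.
  by lm; ring.
rewrite actZ !(L0_phi, Lv, linD (phi_linear _), linZ (phi_linear _)).
have iq := ltn_ord i; rewrite /p -[q.*2.+1]addn1 -muln2 natrB ?(ltnW iq) // !natrD natrM.
by rewrite -[q.+2]addn2 natrD; lm; field; rewrite ?c0 nat1r pnatr_eq0.
Qed.

Let alphaPsi_vacuumD u u' : alphaPsi_vacuum p%:R u -> alphaPsi_vacuum p%:R u' ->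
  alphaPsi_vacuum p%:R (u + u').
Proof.
case=> a1 a0 p0 [a1' a0' p0']; split=> [n n0||n n0]; rewrite actD.
- by rewrite a1 // a1' // addr0.
- by rewrite a0 a0' scalerDr.
- by rewrite p0 // p0' // addr0.
Qed.

Let alphaPsi_vacuumZ a u : alphaPsi_vacuum p%:R u -> alphaPsi_vacuum p%:R (a *: u).
Proof.
case=> a1 a0 p0; split=> [n n0||n n0]; rewrite actZ.
- by rewrite a1 // scaler0.
- by rewrite a0; lm; ring.
- by rewrite p0 // scaler0.
Qed.

Let alphaPsi_vacuum0 : alphaPsi_vacuum p%:R 0.
Proof. by split=> [n n0||n n0]; rewrite ?scaler0 (lin0 (act_lin _)). Qed.

Lemma alphaPsi_vacuum_w_pr : alphaPsi_vacuum p%:R (w_pr c p v).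
Proof.
rewrite w_pr_phi; apply: alphaPsi_vacuumD;
  apply: (big_ind (alphaPsi_vacuum p%:R) alphaPsi_vacuum0 alphaPsi_vacuumD) => k _.
  exact: alphaPsi_vacuum_E (alphaPsi_vacuum_E _ gv).
exact: alphaPsi_vacuumZ (alphaPsi_vacuum_phi _ (alphaPsi_vacuum_phi _ gv)).
Qed.
End Singular.

(** For n >= 1, L(n) is half the anticommutator of G(1/2) and G(n-1/2). *)
Lemma alphaPsi_vacuum_SHplus (p : R[i]) u :
  alphaPsi_vacuum p u -> (forall m : nat, G m%:Z u = 0) ->
  forall x, SHplus x -> act V x u = 0.
Proof.
case=> a1 a0 p0 Gu x; case: x => [n n1|n n1|n n1|n n1|//|//|//].
- have -> : n = (absz (n - 1))%:Z + 1 by move: n1 => /=; lia.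
  have /eqP := G0_G (absz (n - 1)) u.
  rewrite Gu (Gu 0) !(lin0 (act_lin _)) addr0 scaler_eq0 pnatr_eq0 /=.
  by move/eqP.
- by apply: a1; move: n1 => /=; lia.
- by case: n n1.
- exact: p0.
Qed.

(** * Conjugate modes acting as annihilation operators *)

Section Annihilators.
Variables (T : V -> V).
Hypothesis TL : linear T.

(** Only the last summand of [phi] contains Psi(-q-1/2), and its Schur factor is E_0 = 1. *)
Lemma fermion_phi (q : nat) u : (forall n v, T (al n v) = al n (T v)) ->
  (forall n v, T (ps n v) = - ps n (T v) + (n == - q%:Z - 1)%:R *: v) ->
  T u = 0 -> T (phi q.+1 u) = u.
Proof.
move=> Tal Tps Tu; rewrite /phi (lin_sum TL) big_ord_recr /= Tps eqxx subnn.
have TE k : T (E k u) = 0 by rewrite (schur_beta TL) // Tu (lin0 (schur_beta_linear _)).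
rewrite TE (lin0 (act_lin _)) oppr0 add0r scale1r schur0 big1 ?add0r // => l _.
rewrite Tps TE (lin0 (act_lin _)) oppr0 add0r.
by rewrite (_ : (_ == _) = false) ?scale0r //; have := ltn_ord l; lia.
Qed.

Variable p : nat.
Hypothesis Tal : forall n v,
  T (al n v) = al n (T v) + ((n == - p.+1%:Z)%:R * p.+1%:R) *: v.

(** T differentiates with respect to alpha(-p-1), so its bracket with the exponent is
    -z^(p+1)/(2c). *)
Lemma boson_E k u : T (E k u) = E k (T u)
  - (if (p < k)%N then (2%:R * c)^-1 *: E (k - p.+1) u else 0).
Proof.
pose g i v := ((i == p.+1)%:R * - (2%:R * c)^-1) *: v : V.
rewrite (@schur_derivation _ _ _ (betaL _) (betaC _) _ g TL).
- congr (_ + _); case: ltnP => [pk|kp]; last first.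
    rewrite big1 ?oppr0 // => i _.
    by rewrite /g eqSS ltn_eqF ?mul0r ?scale0r // (leq_trans (ltn_ord i)).
  rewrite (bigD1 (Ordinal pk)) //= {1}/g eqxx mul1r big1 ?addr0 ?scaleNr // => i.
  by rewrite -val_eqE /= /g eqSS => /negPf->; rewrite mul0r scale0r.
- by move=> i a x y; rewrite /g; lm; ring.
- by move=> i j v; rewrite /g /beta !actZ; lm; ring.
- move=> i v; rewrite /g /beta (linZ TL) Tal eqr_opp eqz_nat.
  by case: eqP => [->|_]; lm; ring.
Qed.

Hypothesis Tps : forall n v, T (ps n v) = ps n (T v).

Lemma boson_phi k u : (k <= p.+1)%N -> T (phi k u) = phi k (T u).
Proof.
move=> kp; rewrite /phi (lin_sum TL); apply: eq_bigr => l _.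
by rewrite Tps boson_E ltnNge (_ : (k - l.+1 <= p)%N) ?subr0 //; lia.
Qed.
End Annihilators.

(** The bilinears contain no alpha(-2q-1). Among the products E_i E_{2q+1-i} only the two extreme
    ones contain it, and each contributes -1/(2c). *)
Lemma boson_w_pr (T : V -> V) (q : nat) u : linear T ->
  (forall n v, T (al n v) = al n (T v) + ((n == - q.*2.+1%:Z)%:R * q.*2.+1%:R) *: v) ->
  (forall n v, T (ps n v) = ps n (T v)) -> T u = 0 -> alphaPsi_vacuum q.*2.+1%:R u ->
  T (w_pr c q.*2.+1 u) = - c^-1 *: u.
Proof.
move=> TL Tal Tps Tu gu; rewrite (w_pr_phi gu) (linD TL) !(lin_sum TL).
rewrite [X in _ + X]big1 ?addr0 => [|k _]; last first.
  have kq := ltn_ord k.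
  by rewrite (linZ TL) !(boson_phi TL Tal Tps) ?Tu ?(lin0 (phi_linear _)) ?scaler0 //; lia.
have TE k : (k <= q.*2)%N -> T (E k u) = 0.
  by move=> kq; rewrite (boson_E TL Tal) ltnNge kq Tu (lin0 (schur_beta_linear _)) subr0.
have Tp : T (E q.*2.+1 u) = - (2%:R * c)^-1 *: u.
  by rewrite (boson_E TL Tal) ltnSn subnn schur0 Tu (lin0 (schur_beta_linear _)) sub0r scaleNr.
rewrite big_ord_recl big_ord_recr subn0 !schur0 lift0 subnn !schur0 Tp /=.
rewrite big1 ?add0r => [|i _]; first by lm; field.
have iq := ltn_ord i; rewrite (_ : bump 0 i = i.+1) // (boson_E TL Tal) ltnNge.
by rewrite (_ : (i < q.*2)%N) // TE ?(lin0 (schur_beta_linear _)) ?subr0 //; lia.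
Qed.


End SuperHeisenberg.

(** * Transport of the vectors along module homomorphisms *)

Section Morphism.
Variables (R : realType) (V W : SHmodule R) (cL c : R[i]) (f : {linear V -> W}).
Hypothesis (chV : has_charges V cL c) (chW : has_charges W cL c).
Hypothesis fE : forall x u, f (act V x u) = act W x (f u).

Lemma morph_schur t k u : f (schur (beta c t) k u) = schur (beta c t) k (f u).
Proof.
have bL (U : SHmodule R) j : linear (@beta _ U c t j).
  move=> a x y; rewrite /beta linearD linearZ_LR.
  by lmod_with (R[i] : pzRingType) (SHcarrier U); ring.
have bC (U : SHmodule R) (chU : has_charges U cL c) m n x :
    @beta _ U c t m (beta c t n x) = beta c t n (beta c t m x).
  rewrite /beta !linearZ_LR /= (alphaC chU).
  by lmod_with (R[i] : pzRingType) (SHcarrier U); ring.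
elim/ltn_ind: k => -[|k] IHk; first by rewrite !schur0.
have k0 : k.+1%:R != 0 :> R[i] by rewrite pnatr_eq0.
apply: (scalerI k0); rewrite -linearZ_LR (schur_rec (bL V) (bC V chV)).
rewrite (schur_rec (bL W) (bC W chW)) linear_sum; apply: eq_bigr => i _.
by rewrite -IHk ?/beta ?linearZ_LR ?fE //; lia.
Qed.

Lemma morph_phi k u : f (phi c k u) = phi c k (f u).
Proof.
by rewrite /phi linear_sum; apply: eq_bigr => l _; rewrite fE morph_schur.
Qed.

End Morphism.

(** * Free field modules *)

(* bos true n is alpha(n) and bos false n the n-th mode of the conjugate boson;  *)
(* fer s n is the mode n + 1/2 of a fermion, fer true n being Psi(n + 1/2).      *)
Record freeFields (R : realType) := FreeFields {
  ff_space :> lmodType R[i];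
  bos : bool -> int -> {linear ff_space -> ff_space};
  fer : bool -> int -> {linear ff_space -> ff_space};
  zmode : bool -> R[i];
  vac : ff_space;
  bos0 : forall s u, bos s 0 u = zmode s *: u;
  bos_bos : forall s t m n u, bos s m (bos t n u) =
    bos t n (bos s m u) + (((s != t) && (m + n == 0))%:R * m%:~R) *: u;
  bos_fer : forall s t m n u, bos s m (fer t n u) = fer t n (bos s m u);
  fer_fer : forall s t m n u, fer s m (fer t n u) =
    - fer t n (fer s m u) + ((s != t) && (m + n + 1 == 0))%:R *: u;
  vac_neq0 : vac != 0;
  bos_vac : forall s (n : int), 0 < n -> bos s n vac = 0;
  fer_vac : forall s (n : int), 0 <= n -> fer s n vac = 0;
  ff_ind : forall P : ff_space -> Prop, P vac ->
    (forall u v, P u -> P v -> P (u + v)) -> (forall a u, P u -> P (a *: u)) ->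
    (forall s n u, P u -> P (bos s n u)) -> (forall s n u, P u -> P (fer s n u)) ->
    forall u, P u
}.

(** * The action on free fields *)

Section SuperVirasoro.
Variables (R : realType) (F : freeFields R) (e : bool -> R[i]).
Local Notation C := R[i].
Local Notation bos := (@bos R F).
Local Notation fer := (@fer R F).
Local Notation z := (@zmode R F).
Implicit Types (u : F) (k m n : int) (s t : bool).

Local Ltac lm := lmod_with (R[i] : pzRingType) (ff_space F).

Lemma ff_finite u : exists N : nat, forall s n, N%:Z <= n ->
  bos s n u = 0 /\ fer s n u = 0.
Proof.
elim/(@ff_ind R F): u => [|u v [N HN] [M HM]|a u [N HN]|t k u [N HN]|t k u [N HN]].
- by exists 1%N => s n n1; rewrite bos_vac ?fer_vac //; lia.
- exists (maxn N M) => s n nNM; rewrite !linearD /=.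
  have [-> ->] : bos s n u = 0 /\ fer s n u = 0 by apply: HN; lia.
  have [-> ->] : bos s n v = 0 /\ fer s n v = 0 by apply: HM; lia.
  by rewrite addr0.
- by exists N => s n nN; rewrite !linearZ /=; case: (HN s n nN) => -> ->; rewrite scaler0.
- exists (maxn N `|k|.+1) => s n nN.
  have [b0 f0] : bos s n u = 0 /\ fer s n u = 0 by apply: HN; lia.
  rewrite bos_bos -bos_fer b0 f0 !linear0 (_ : n + k == 0 = false); last by lia.
  by rewrite andbF mul0r scale0r addr0.
- exists (maxn N `|k|.+1) => s n nN.
  have [b0 f0] : bos s n u = 0 /\ fer s n u = 0 by apply: HN; lia.
  rewrite fer_fer bos_fer b0 f0 !linear0 (_ : n + k + 1 == 0 = false); last by lia.
  by rewrite andbF scale0r addr0.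
Qed.

(** Bosons commute with fermions, so the products need no normal ordering. *)
Definition Gterm n u k : F :=
  bos true k (fer false (n - k) u) + bos false k (fer true (n - k) u).

(* e true = c_{L,alpha} and e false are the background charges.  The operators   *)
(* are locked because rewriting with linearity would otherwise unfold them.      *)
Fact Gop_key : unit. Proof. exact: tt. Qed.
Definition Gop n : F -> F := locked_with Gop_key (fun u =>
  \sum_(k \in [set: int]) Gterm n u k
  - (2%:R * (n + 1)%:~R) *: (e true *: fer false n u + e false *: fer true n u)).

Lemma GopE n u : Gop n u = \sum_(k \in [set: int]) Gterm n u k
  - (2%:R * (n + 1)%:~R) *: (e true *: fer false n u + e false *: fer true n u).
Proof. by rewrite /Gop unlock. Qed.

Definition window_covers n u (N : nat) := forall M, (N <= M)%N ->
  \sum_(k \in [set: int]) Gterm n u k = \sum_(k <- window M) Gterm n u k.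

Lemma Gterm_window n u : exists N, window_covers n u N.
Proof.
have [N HN] := ff_finite u; exists (N + `|n|).+1 => M NM.
apply: fsbig_support (window_uniq _) _ => k; rewrite mem_window /Gterm => kM.
have [kN|kN] := lerP N%:Z k.
  by rewrite !bos_fer !(HN _ k kN).1 !linear0 addr0.
have nk : N%:Z <= n - k by lia.
by rewrite !(HN _ _ nk).2 !linear0 addr0.
Qed.

Lemma Gterm_linear n k : linear (Gterm n ^~ k).
Proof.
move=> a u v; rewrite /Gterm !linearD !linearZ /=.
lm; ring.
Qed.

Lemma Gop_linear n : linear (Gop n).
Proof.
move=> a u v; rewrite !GopE.
have [Nu Hu] := Gterm_window n u; have [Nv Hv] := Gterm_window n v.
have [N H] := Gterm_window n (a *: u + v).
pose M := maxn N (maxn Nu Nv).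
rewrite (Hu M) 1?(Hv M) 1?(H M); try by rewrite /M; lia.
have -> : \sum_(k <- window M) Gterm n (a *: u + v) k =
    a *: \sum_(k <- window M) Gterm n u k + \sum_(k <- window M) Gterm n v k.
  by rewrite scaler_sumr -big_split; apply: eq_bigr => k _; rewrite Gterm_linear.
rewrite !linearD !linearZ /=; lm; ring.
Qed.
HB.instance Definition _ n := GRing.isLinear.Build R[i] F F *:%R (Gop n) (Gop_linear n).

Lemma Gop_bos n s m u : Gop n (bos s m u) = bos s m (Gop n u) - m%:~R *: fer s (m + n) u.
Proof.
have [N H] := Gterm_window n u; have [N' H'] := Gterm_window n (bos s m u).
pose M := maxn `|m|.+1 (maxn N N').
rewrite !GopE (H M) ?(H' M); try by rewrite /M; lia.
have mM : - m \in window M by rewrite mem_window /M; lia.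
have -> : \sum_(k <- window M) Gterm n (bos s m u) k =
    bos s m (\sum_(k <- window M) Gterm n u k)
    - \sum_(k <- window M | k == - m) m%:~R *: fer s (n - k) u.
  rewrite [bos s m (\sum_(_ <- _) _)]linear_sum [X in _ - X]big_mkcond /= -sumrB.
  apply: eq_bigr => k _; rewrite /Gterm !linearD /= -!bos_fer !(bos_bos s).
  have -> : (k == - m) = (m + k == 0) by lia.
  case: (eqVneq (m + k) 0) => [mk|_]; last first.
    by rewrite !andbF; lm; ring.
  by case: s {H'}; rewrite /= ?andbT !bos_fer; lm; ring.
rewrite sum_window1 // opprK.
have -> : n + m = m + n by rewrite addrC.
by rewrite !(linearD, linearZ, linearB, linearN) /= -!bos_fer; lm; ring.
Qed.

Lemma Gop_fer n s m u : Gop n (fer s m u) = - fer s m (Gop n u) + bos s (m + n + 1) u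
   + ((m + n + 1 == 0)%:R * (2%:Z * m)%:~R * e s) *: u.
Proof.
have [N H] := Gterm_window n u; have [N' H'] := Gterm_window n (fer s m u).
pose M := maxn `|m + n + 1|.+1 (maxn N N').
rewrite !GopE (H M) ?(H' M); try by rewrite /M; lia.
have mM : m + n + 1 \in window M by rewrite mem_window /M; lia.
have -> : \sum_(k <- window M) Gterm n (fer s m u) k =
    - fer s m (\sum_(k <- window M) Gterm n u k)
    + \sum_(k <- window M | k == m + n + 1) bos s k u.
  rewrite [fer s m (\sum_(_ <- _) _)]linear_sum [X in _ + X]big_mkcond /= -sumrN -big_split.
  apply: eq_bigr => k _; rewrite /Gterm !linearD /= -!bos_fer !(fer_fer s).
  have -> : (k == m + n + 1) = (m + (n - k) + 1 == 0) by lia.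
  case: (eqVneq (m + (n - k) + 1) 0) => [mk|_]; last first.
    by rewrite !andbF !scale0r !addr0 !linearN /=; lm; ring.
  by case: s {H'}; rewrite /= ?scale0r ?scale1r !linearD !linearN /= ?linear0; lm; ring.
rewrite sum_window1 //.
rewrite !(linearD, linearZ, linearB, linearN) /= !(fer_fer s).
case: (eqVneq (m + n + 1) 0) => [mk|_].
  have -> : n = - m - 1 by lia.
  by case: s {H'}; rewrite /= ?scale0r ?scale1r ?addr0; lm;
    rewrite ?mulrNz ?rmorphD ?rmorphN ?rmorphM /=; ring.
by rewrite !andbF; lm; ring.
Qed.

Lemma GopD n u v : Gop n (u + v) = Gop n u + Gop n v. Proof. exact: linearD. Qed.
Lemma GopN n u : Gop n (- u) = - Gop n u. Proof. exact: linearN. Qed.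
Lemma GopZ n a u : Gop n (a *: u) = a *: Gop n u. Proof. exact: linearZ. Qed.
Definition GopL := (GopD, GopN, GopZ).
Lemma bosD s n u v : bos s n (u + v) = bos s n u + bos s n v. Proof. exact: linearD. Qed.
Lemma bosN s n u : bos s n (- u) = - bos s n u. Proof. exact: linearN. Qed.
Lemma bosZ s n a u : bos s n (a *: u) = a *: bos s n u. Proof. exact: linearZ. Qed.
Definition bosL := (bosD, bosN, bosZ).
Lemma ferD s n u v : fer s n (u + v) = fer s n u + fer s n v. Proof. exact: linearD. Qed.
Lemma ferN s n u : fer s n (- u) = - fer s n u. Proof. exact: linearN. Qed.
Lemma ferZ s n a u : fer s n (a *: u) = a *: fer s n u. Proof. exact: linearZ. Qed.
Definition ferL := (ferD, ferN, ferZ).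

Definition Ganti m n : F -> F :=
  locked_with Gop_key (fun u => Gop m (Gop n u) + Gop n (Gop m u)).

Lemma GantiE m n u : Ganti m n u = Gop m (Gop n u) + Gop n (Gop m u).
Proof. by rewrite /Ganti unlock. Qed.

Lemma Ganti_linear m n : linear (Ganti m n).
Proof. by move=> a u v; rewrite !GantiE !linearD !linearZ /=; lm; ring. Qed.
HB.instance Definition _ m n :=
  GRing.isLinear.Build R[i] F F *:%R (Ganti m n) (Ganti_linear m n).

(* {G(1/2), G(n-1/2)} = 2 L(n) has no central term, for any n.                   *)
Definition Lop n : F -> F := locked_with Gop_key (fun u => 2%:R^-1 *: Ganti 0 (n - 1) u).

Lemma LopE n u : Lop n u = 2%:R^-1 *: Ganti 0 (n - 1) u.
Proof. by rewrite /Lop unlock. Qed.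

Lemma Lop_linear n : linear (Lop n).
Proof. by move=> a u v; rewrite !LopE linearD linearZ /=; lm; ring. Qed.
HB.instance Definition _ n := GRing.isLinear.Build R[i] F F *:%R (Lop n) (Lop_linear n).

Lemma Ganti_bos m n s k u : Ganti m n (bos s k u) = bos s k (Ganti m n u)
  - (2%:R * k%:~R) *: (bos s (m + n + 1 + k) u
       + ((m + n + 1 + k == 0)%:R * (k - 1)%:~R * e s) *: u).
Proof.
rewrite !GantiE !(Gop_bos, Gop_fer, GopL, bosL).
have -> : k + n + m + 1 = m + n + 1 + k by lia.
have -> : k + m + n + 1 = m + n + 1 + k by lia.
case: (eqVneq (m + n + 1 + k) 0) => [mk|_] /=; last by lm; ring.
have -> : k = - m - n - 1 by lia.
by lm; rewrite ?rmorphD ?rmorphM ?rmorphD ?rmorphN /=; ring.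
Qed.

Lemma Ganti_fer m n s k u : Ganti m n (fer s k u) = fer s k (Ganti m n u)
  - (2%:Z * k + m + n + 2%:Z)%:~R *: fer s (m + n + 1 + k) u.
Proof.
rewrite !GantiE !(Gop_bos, Gop_fer, GopL, ferL).
have -> : k + n + 1 + m = m + n + 1 + k by lia.
have -> : k + m + 1 + n = m + n + 1 + k by lia.
by lm; rewrite ?rmorphD ?rmorphM /=; ring.
Qed.

Lemma Lop_bos n s k u : Lop n (bos s k u) = bos s k (Lop n u)
  - k%:~R *: (bos s (n + k) u + ((n + k == 0)%:R * (k - 1)%:~R * e s) *: u).
Proof.
rewrite !LopE Ganti_bos bosZ.
have -> : 0 + (n - 1) + 1 + k = n + k by lia.
by lm; field.
Qed.

Lemma Lop_fer n s k u : Lop n (fer s k u) = fer s k (Lop n u)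
  - ((2%:Z * k + n + 1)%:~R / 2%:R) *: fer s (n + k) u.
Proof.
rewrite !LopE Ganti_fer ferZ.
have -> : 0 + (n - 1) + 1 + k = n + k by lia.
have -> : 2%:Z * k + 0 + (n - 1) + 2%:Z = 2%:Z * k + n + 1 by lia.
by lm; field.
Qed.

Lemma Gop_super_commute (X : {linear F -> F}) (eps : C) n u :
  (forall s k v, X (bos s k v) = bos s k (X v)) ->
  (forall s k v, X (fer s k v) = eps *: fer s k (X v)) ->
  X (Gop n u) = eps *: Gop n (X u).
Proof.
move=> Xb Xf.
have [N H] := Gterm_window n u; have [N' H'] := Gterm_window n (X u).
pose M := maxn N N'.
rewrite !GopE (H M) ?(H' M); try by rewrite /M; lia.
have XS : X (\sum_(k <- window M) Gterm n u k) = eps *: \sum_(k <- window M) Gterm n (X u) k.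
  rewrite linear_sum scaler_sumr; apply: eq_bigr => k _.
  by rewrite /Gterm linearD /= !Xb !Xf !linearZ /=; lm; ring.
by rewrite linearB /= XS linearZ linearD !linearZ /= !Xf; lm; ring.
Qed.

Lemma Lop0_Gop n u : Lop 0 (Gop n u) = Gop n (Lop 0 u) - (n%:~R + 2%:R^-1) *: Gop n u.
Proof.
have [N H] := Gterm_window n u; have [N' H'] := Gterm_window n (Lop 0 u).
pose M := maxn N N'.
rewrite !GopE (H M) ?(H' M); try by rewrite /M; lia.
have -> : Lop 0 (\sum_(k <- window M) Gterm n u k
      - (2%:R * (n + 1)%:~R) *: (e true *: fer false n u + e false *: fer true n u)) =
    \sum_(k <- window M) Lop 0 (Gterm n u k)
      - (2%:R * (n + 1)%:~R) *: 
        (e true *: Lop 0 (fer false n u) + e false *: Lop 0 (fer true n u)).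
  by rewrite linearB linear_sum /= !linearZ linearD /= !linearZ.
have -> : \sum_(k <- window M) Lop 0 (Gterm n u k) =
   \sum_(k <- window M) Gterm n (Lop 0 u) k
   - (n%:~R + 2%:R^-1) *: \sum_(k <- window M) Gterm n u k.
  rewrite scaler_sumr -sumrB; apply: eq_bigr => k _.
  rewrite /Gterm linearD /= !Lop_bos !Lop_fer !add0r.
  rewrite !(linearB, linearN, linearZ) /=.
  by case: (eqVneq k 0) => [->|k0] /=; lm; rewrite ?rmorphD ?rmorphM ?rmorphB /=; field.
by rewrite !Lop_fer !add0r; lm; rewrite ?rmorphD ?rmorphM ?rmorphB /=; field.
Qed.

(** L(0) is quadratic in G, so X passes it with the sign eps^2 = 1; since X also shifts the weight
    by w, w X = 0. It is applied below to the defect of each expected relation. *)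
Lemma super_commute_eq0 (X : F -> F) (eps w : C) u : linear X ->
  (forall s k v, X (bos s k v) = bos s k (X v)) ->
  (forall s k v, X (fer s k v) = eps *: fer s k (X v)) ->
  eps ^+ 2 = 1 -> w != 0 ->
  (forall v, Lop 0 (X v) = X (Lop 0 v) - w *: X v) -> X u = 0.
Proof.
move=> XL Xb Xf eps2 w0 /(_ u).
pose XX := HB.pack_for {linear F -> F} X (GRing.isLinear.Build R[i] F F *:%R X XL).
have XZ a v : X (a *: v) = a *: X v by exact: (linearZ_LR XX).
have XD v v' : X (v + v') = X v + X v' by exact: (linearD XX).
have XG n v : X (Gop n v) = eps *: Gop n (X v) by exact: (@Gop_super_commute XX).
have -> : X (Lop 0 u) = Lop 0 (X u).
  by rewrite !LopE !GantiE XZ XD !XG !GopZ !scalerA -expr2 eps2 !scale1r.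
move/eqP; rewrite -subr_eq0 opprB addrC subrK scaler_eq0 (negPf w0) /=.
by move/eqP.
Qed.

Lemma LopD n u v : Lop n (u + v) = Lop n u + Lop n v. Proof. exact: linearD. Qed.
Lemma LopN n u : Lop n (- u) = - Lop n u. Proof. exact: linearN. Qed.
Lemma LopZ n a u : Lop n (a *: u) = a *: Lop n u. Proof. exact: linearZ. Qed.
Definition LopL := (LopD, LopN, LopZ).

Lemma GantiD m n u v : Ganti m n (u + v) = Ganti m n u + Ganti m n v.
Proof. exact: linearD. Qed.
Lemma GantiZ m n a u : Ganti m n (a *: u) = a *: Ganti m n u. Proof. exact: linearZ. Qed.

Lemma half_int_neq0 (n : int) : n%:~R + 2%:R^-1 != 0 :> C.
Proof.
have -> : n%:~R + 2%:R^-1 = (2%:Z * n + 1)%:~R / 2%:R :> C.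
  by rewrite rmorphD rmorphM /=; field.
rewrite mulf_neq0 ?invr_neq0 ?pnatr_eq0 // intr_eq0; lia.
Qed.

Lemma Lop0_Ganti m n u :
  Lop 0 (Ganti m n u) = Ganti m n (Lop 0 u) - (m + n + 1)%:~R *: Ganti m n u.
Proof.
by rewrite !GantiE LopD !Lop0_Gop !(GopL, Lop0_Gop); lm; rewrite ?(rmorphD) /=; field.
Qed.

Lemma Lop0_Lop n u : Lop 0 (Lop n u) = Lop n (Lop 0 u) - n%:~R *: Lop n u.
Proof.
rewrite !(LopE n) LopZ Lop0_Ganti add0r subrK.
by lm; ring.
Qed.

(** The defect is odd, of weight m+n+1/2, which never vanishes, so there is no exceptional case. *)
Lemma Lop_Gop m n u : Lop m (Gop n u) =
  Gop n (Lop m u) + (m%:~R / 2%:R - n%:~R - 2%:R^-1) *: Gop (m + n) u.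
Proof.
apply/eqP; rewrite -subr_eq0 opprD addrA; apply/eqP.
pose X v := Lop m (Gop n v) - Gop n (Lop m v)
  - (m%:~R / 2%:R - n%:~R - 2%:R^-1) *: Gop (m + n) v.
apply: (@super_commute_eq0 X (-1) ((m + n)%:~R + 2%:R^-1)).
- by move=> a v w; rewrite /X !(GopL, LopL); lm; ring.
- move=> s k v; rewrite /X !(Gop_bos, Lop_bos, Lop_fer, GopL, LopL, bosL).
  have -> : k + (m + n) = m + n + k by lia.
  have -> : m + (k + n) = m + n + k by lia.
  have -> : m + k + n = m + n + k by lia.
  by lm; rewrite ?rmorphD ?rmorphM /= ?rmorphD /=; field.
- move=> s k v; rewrite /X !(Gop_fer, Lop_bos, Lop_fer, GopL, LopL, ferL).
  have -> : k + (m + n) + 1 = m + n + k + 1 by lia.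
  have -> : m + (k + n + 1) = m + n + k + 1 by lia.
  have -> : m + k + n + 1 = m + n + k + 1 by lia.
  case: (eqVneq (m + n + k + 1) 0) => [z0|_] /=; last first.
    by lm; rewrite ?rmorphD ?rmorphM /= ?rmorphD /=; field.
  have -> : k = - m - n - 1 by lia.
  by lm; rewrite ?(rmorphD, rmorphM, rmorphN) /= ?(rmorphD, rmorphM, rmorphN) /=; field.
- by rewrite expr2 mulrNN mulr1.
- exact: half_int_neq0.
- move=> v; rewrite /X !(LopL, Lop0_Gop, Lop0_Lop, GopL).
  by lm; rewrite ?(rmorphD, rmorphM, rmorphN) /=; field.
Qed.

Lemma Ganti_Lop m n u : m + n + 1 != 0 -> Ganti m n u = 2%:R *: Lop (m + n + 1) u.
Proof.
move=> mn0; apply/eqP; rewrite -subr_eq0; apply/eqP.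
pose X v := Ganti m n v - 2%:R *: Lop (m + n + 1) v.
apply: (@super_commute_eq0 X 1 (m + n + 1)%:~R).
- by move=> a v w; rewrite /X !GantiE !(GopL, LopL); lm; ring.
- move=> s k v; rewrite /X Ganti_bos Lop_bos !bosL.
  by lm; rewrite ?(rmorphD, rmorphM, rmorphN) /=; ring.
- move=> s k v; rewrite /X Ganti_fer Lop_fer !ferL.
  by lm; rewrite ?(rmorphD, rmorphM, rmorphN) /= ?(rmorphD, rmorphM, rmorphN) /=; field.
- by rewrite expr1n.
- by rewrite intr_eq0.
- move=> v; rewrite /X !LopL Lop0_Ganti Lop0_Lop.
  by lm; rewrite ?(rmorphD, rmorphM, rmorphN) /=; ring.
Qed.

Lemma Lop_Ganti m n k u : Lop m (Ganti n k u) = Ganti n k (Lop m u)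
  + (m%:~R / 2%:R - n%:~R - 2%:R^-1) *: Ganti (m + n) k u
  + (m%:~R / 2%:R - k%:~R - 2%:R^-1) *: Ganti n (m + k) u.
Proof. by rewrite !GantiE LopD !Lop_Gop !(GopL, Lop_Gop); lm; ring. Qed.

Lemma GantiC m n u : Ganti m n u = Ganti n m u.
Proof. by rewrite !GantiE addrC. Qed.

Lemma Ganti0 n u : Ganti 0 n u = 2%:R *: Lop (n + 1) u.
Proof. by rewrite LopE scalerA divff ?pnatr_eq0 // scale1r addrK. Qed.

Lemma Gop_vac n : 0 <= n -> Gop n (@vac R F) = 0.
Proof.
move=> n0; rewrite GopE (@fsbig_support _ _ _ [::]) //.
  by rewrite big_nil !fer_vac // !scaler0 addr0 scaler0 subr0.
move=> k _; rewrite /Gterm; have [k0|k0] := lerP k 0.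
  by rewrite !fer_vac ?linear0 ?addr0 //; lia.
by rewrite !bos_fer !bos_vac // !linear0 addr0.
Qed.

(** The pair of bosons contributes 2 and the pair of fermions 1; the rest comes from the background
    charges. *)
Definition charge : C := 3%:R - 24%:R * e true * e false.

Definition vacuum_weight : C :=
  zmode F true * zmode F false - e true * zmode F false - e false * zmode F true.

Lemma Gop_vacN1 : Gop (-1) (@vac R F) =
  z false *: fer true (-1) (@vac R F) + z true *: fer false (-1) (@vac R F).
Proof.
rewrite GopE (@fsbig_support _ _ _ [:: 0]) //.
  rewrite big_seq1 /Gterm subr0 !bos0 addNr mulr0 scale0r subr0.
  by rewrite addrC.
move=> k; rewrite inE /Gterm => k0; have [kn|kp] := lerP k 0.
  by rewrite !fer_vac ?linear0 ?addr0 //; lia.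
by rewrite !bos_fer !bos_vac // !linear0 addr0.
Qed.

Lemma Gop_vacN2 : Gop (-2) (@vac R F) =
  (z false + 2%:R * e false) *: fer true (-2) (@vac R F)
  + (z true + 2%:R * e true) *: fer false (-2) (@vac R F)
  + bos true (-1) (fer false (-1) (@vac R F)) + bos false (-1) (fer true (-1) (@vac R F)).
Proof.
rewrite GopE (@fsbig_support _ _ _ [:: 0; -1]) //.
  by rewrite !big_cons big_nil /Gterm subr0 !bos0; lm; ring.
move=> k; rewrite !inE /Gterm => k0; have [kn|kp] := lerP k 0.
  by rewrite !fer_vac ?linear0 ?addr0 //; lia.
by rewrite !bos_fer !bos_vac // !linear0 addr0.
Qed.

Lemma Lop0_vac : Lop 0 (@vac R F) = vacuum_weight *: @vac R F.
Proof.
rewrite LopE GantiE sub0r Gop_vacN1 !(GopL, Gop_fer) !(Gop_vac (lexx 0)) /=.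
rewrite !linear0 !bos0 /vacuum_weight.
by lm; field.
Qed.

(** Both sides have the same commutators with all modes, so the vacuum decides. *)
Lemma Ganti1 u : Ganti 1 (-2) u = 2%:R *: Lop 0 u + (2%:R * charge / 3%:R) *: u.
Proof.
rewrite -(Ganti0 (-1)).
elim/(@ff_ind R F): u => [|u v Hu Hv|a u Hu|s k u Hu|s k u Hu].
- rewrite !GantiE !(Gop_vac (lexx 0), Gop_vac ler01) Gop_vacN1 Gop_vacN2.
  rewrite !(GopL, Gop_fer, Gop_bos, bosL) !(Gop_vac (lexx 0), Gop_vac ler01) /=.
  rewrite !linear0 !bos0 !(bos_vac _ _ (ltr01 : 0 < 1 :> int)).
  rewrite !(fer_fer _ _ 0) !(fer_vac _ _ (lexx (0 : int))) !linear0.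
  by rewrite /charge; lm; field.
- by rewrite !GantiD Hu Hv; lm; ring.
- by rewrite !GantiZ Hu; lm; ring.
- by rewrite !Ganti_bos Hu !bosL; lm; ring.
- by rewrite !Ganti_fer Hu !ferL; lm; ring.
Qed.

(* The Jacobi identity of L(a), G(b), G(-a-b-1), compared for b = 0 and b = -1,  *)
(* determines the anticommutator for a > 1 from the one for a - 1.               *)
Lemma Ganti_diag (a : nat) u : Ganti a%:Z (- a%:Z - 1) u =
  2%:R *: Lop 0 u + ((a%:Z ^+ 2 + a%:Z)%:~R / 3%:R * charge) *: u.
Proof.
elim: a => [|[|a] IHa].
- by rewrite (Ganti0 (-1)); lm; field.
- by rewrite (Ganti1 u); lm; field.
pose k : int := a.+2; have k0 : k != 0 by [].
have -> : - a.+2%:Z - 1 = - k - 1 by [].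
have E w : Ganti 0 (- k - 1) w = Ganti (- 1) (- k) w.
  rewrite Ganti0 subrK Ganti_Lop; last by lia.
  by congr (_ *: Lop _ _); lia.
have := Lop_Ganti k (-1) (- k) u; rewrite -!E Lop_Ganti -!addrA => /addrI.
rewrite addr0 subrr (GantiC (-1)).
have -> : k + (- k - 1) = -1 by lia.
have -> : - k = - a.+1%:Z - 1 by lia.
have -> : k - 1 = a.+1%:Z by lia.
rewrite IHa (Ganti0 (-1)) (_ : (-1 + 1)%R = 0 :> int) // => H.
(* This factor is (k-1)/2. It vanishes at k = 1, which is why that case was settled on the
   vacuum. *)
have a1 : k%:~R / 2%:R + (- 0%:~R - 2%:R^-1) != 0 :> C.
  have -> : k%:~R / 2%:R + (- 0%:~R - 2%:R^-1) = a.+1%:R / 2%:R :> C.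
    by rewrite /k -[a.+2]addn1 pmulrn PoszD rmorphD /=; field.
  by rewrite mulf_neq0 ?invr_eq0 ?pnatr_eq0.
apply: (scalerI a1); move/(canRL (addrK _)): H => ->.
rewrite /k -[a.+2]addn1 -[a.+1]addn1 !PoszD.
by lm; rewrite !(rmorphD, rmorphXn, rmorphN) /= ?(rmorphD, rmorphXn, rmorphN) /=; field.
Qed.

Lemma Ganti_gen m n u : Ganti m n u = 2%:R *: Lop (m + n + 1) u
  + ((m + n + 1 == 0)%:R * ((m ^+ 2 + m)%:~R / 3%:R * charge)) *: u.
Proof.
case: (eqVneq (m + n + 1) 0) => [mn0|mn0]; last first.
  by rewrite Ganti_Lop // mul0r scale0r addr0.
rewrite mul1r mn0; have [m0|m0] := lerP 0 m.
  have -> : n = - m - 1 by lia.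
  by case: m m0 mn0 => // a _ _; exact: Ganti_diag.
rewrite GantiC; have -> : m = - n - 1 by lia.
have : 0 <= n by lia.
case: n {mn0} => // a _; rewrite Ganti_diag.
by lm; rewrite ?(rmorphD, rmorphXn, rmorphN) /=; field.
Qed.


Lemma Lop_Lop m n u : Lop m (Lop n u) = Lop n (Lop m u) + (m - n)%:~R *: Lop (m + n) u
  + ((m + n == 0)%:R * ((m ^+ 3 - m)%:~R / 12%:R * charge)) *: u.
Proof.
rewrite !(LopE n) LopZ Lop_Ganti addr0 (Ganti_gen m) (Ganti0 (m + (n - 1))).
have -> : m + (n - 1) + 1 = m + n by lia.
by lm; rewrite ?(rmorphB, rmorphD, rmorphXn, rmorphN) /=; field.
Qed.

Definition ff_act (x : SHbasis) : {linear F -> F} :=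
  match x with
  | SH_L n => Lop n
  | SH_alpha n => bos true n
  | SH_G n => Gop n
  | SH_Psi n => fer true n
  | SH_CL => *:%R charge
  | SH_Calpha => \0
  | SH_CLalpha => *:%R (e true)
  end.

Program Definition ff_module : SHmodule R :=
  @Build_SHmodule R F ff_act _ _ _ _ _ _ _ _ _ _ _ _ _.
Next Obligation. by rewrite /comm /= linearZ /= subrr. Qed.
Next Obligation. by rewrite /comm /= linear0 subrr. Qed.
Next Obligation. by rewrite /comm /= linearZ /= subrr. Qed.
Next Obligation. by rewrite /comm /= bos_bos mul0r scale0r addr0 subrr scaler0. Qed.
Next Obligation.
rewrite /comm /= Lop_bos; case: (eqVneq (m + n) 0) => [mn0|_] /=; last by lm; ring.
have -> : n = - m by lia.
by lm; rewrite ?(rmorphB, rmorphD, rmorphXn, rmorphN) /=; ring.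
Qed.
Next Obligation. by rewrite /comm /= Lop_Lop; lm; ring. Qed.
Next Obligation. by rewrite /acomm /= fer_fer scale0r addr0 addNr scaler0. Qed.
Next Obligation. by rewrite /comm /= bos_fer subrr. Qed.
Next Obligation. by rewrite /acomm /= -GantiE Ganti_gen scalerA mulrA. Qed.
Next Obligation. by rewrite /comm /= Lop_Gop; lm; ring. Qed.
Next Obligation. by rewrite /comm /= Gop_bos; lm; ring. Qed.
Next Obligation. by rewrite /comm /= Lop_fer (addrC n m); lm; ring. Qed.
Next Obligation. by rewrite /acomm /= Gop_fer; lm; ring. Qed.

End SuperVirasoro.

(** * The Fock space *)

Section Occupation.
Variables (R : realType) (z : bool -> R[i]).
Local Notation C := R[i].

(* Occupation numbers of the bosons and of the fermions.  The fermions are       *)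
(* ordered by pickle, so that the sign in toggle is a finite product.            *)
Definition occ := ((int -> nat) * (nat -> bool))%type.
Local Notation P := (occ -> C^o).
Implicit Types (f g : P) (x : int -> nat) (y : nat -> bool).

Definition shift (k : int) (d : nat -> nat) x : int -> nat :=
  fun j => if j == k then d (x j) else x j.

(** Reading f as the Taylor series of the f(s) x^s/s!, [raise] is multiplication by x_k and [lower]
    is the derivative. At occupation 0 the prefactor kills the default value of [predn]. *)
Definition raise (k : int) f : P := fun s => (s.1 k)%:R * f (shift k predn s.1, s.2).
Definition lower (k : int) f : P := fun s => f (shift k succn s.1, s.2).

(* The k-th oscillator, k <> 0, is made of alpha(k) and of the mode -k of the    *)
(* conjugate boson; likewise for the fermions with modes k + 1/2 and -(k + 1/2). *)
Definition obos (s : bool) (n : int) f : P :=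
  if n == 0 then z s *: f
  else if s then (if n < 0 then raise n f else lower n f)
  else if n < 0 then (- n)%:~R *: raise (- n) f else n%:~R *: lower (- n) f.

Definition flip (i : nat) y : nat -> bool := fun j => (j == i) (+) y j.

(** The Jordan-Wigner sign, which makes distinct fermion modes anticommute. *)
Definition sgn (i : nat) y : C := \prod_(k < i) (-1) ^+ y k.

Definition toggle (i : nat) (b : bool) f : P :=
  fun s => sgn i s.2 * (s.2 i == b)%:R * f (s.1, flip i s.2).

Definition ofer (s : bool) (n : int) f : P :=
  toggle (pickle (if s then n else - n - 1)) (n < 0) f.

Definition ovac : P := fun s => `[< s = (fun=> 0%N, fun=> false) >]%:R.

Lemma shiftC j k d d' x : j != k -> shift j d (shift k d' x) = shift k d' (shift j d x).
Proof.
move=> jk; apply: funext => i; rewrite /shift.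
by case: (eqVneq i j) => [->|//]; rewrite (negPf jk).
Qed.

Lemma lowerC j k f : lower j (lower k f) = lower k (lower j f).
Proof.
apply: funext => -[x y]; rewrite /lower /=.
by have [->//|jk] := eqVneq j k; rewrite shiftC // eq_sym.
Qed.

Lemma raiseC j k f : raise j (raise k f) = raise k (raise j f).
Proof.
have [->//|jk] := eqVneq j k.
apply: funext => -[x y]; rewrite /raise /= (shiftC _ _ _ jk).
have -> : shift j predn x k = x k by rewrite /shift eq_sym (negPf jk).
have -> : shift k predn x j = x j by rewrite /shift (negPf jk).
by rewrite mulrCA.
Qed.

Lemma lower_raise j k f : lower j (raise k f) = raise k (lower j f) + (j == k)%:R *: f.
Proof.
apply: funext => -[x y]; rewrite /lower /raise [RHS]/= !fctE /=.
case: (eqVneq j k) => [->|jk]; last first.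
  rewrite scale0r addr0 (shiftC _ _ _ jk) /shift.
  by rewrite [k == j]eq_sym (negPf jk).
have -> : shift k predn (shift k succn x) = x.
  by apply: funext => i; rewrite /shift; case: eqVneq.
rewrite scale1r {1}/shift eqxx; case xk : (x k) => [|n].
  by rewrite mul0r add0r mul1r.
have -> : shift k succn (shift k predn x) = x.
  by apply: funext => i; rewrite /shift; case: eqVneq => // ->; rewrite xk.
by rewrite -[n.+2]addn1 natrD mulrDl mul1r.
Qed.

Lemma flipC i j y : flip i (flip j y) = flip j (flip i y).
Proof. by apply: funext => k; rewrite /flip addbCA. Qed.

Lemma flipK i : involutive (flip i).
Proof. by move=> y; apply: funext => k; rewrite /flip addbA addbb. Qed.

Lemma sgn_flip i j y : sgn i (flip j y) = (-1) ^+ (j < i) * sgn i y.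
Proof.
rewrite /sgn; have [ji|ij] := ltnP j i.
  rewrite (bigD1 (Ordinal ji)) //= [in RHS](bigD1 (Ordinal ji)) //= /flip eqxx.
  rewrite mulrA signr_addb; congr (_ * _); apply: eq_bigr => k.
  by rewrite -val_eqE /= => /negPf->.
rewrite mul1r; apply: eq_bigr => k _; rewrite /flip ltn_eqF //.
exact: leq_trans (ltn_ord k) ij.
Qed.

Lemma sgn_sqr i y : sgn i y * sgn i y = 1.
Proof.
by rewrite -big_split big1 // => k _ /=; rewrite -expr2 sqrr_sign.
Qed.

Lemma toggle_toggle i j b d f : toggle i b (toggle j d f) =
  - toggle j d (toggle i b f) + ((i == j) && (b != d))%:R *: f.
Proof.
apply: funext => -[x y]; rewrite /toggle [RHS]/= !fctE /=.
have [->|ij] := eqVneq i j.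
  rewrite flipK !sgn_flip ltnn mul1r /flip eqxx /=.
  have := sgn_sqr j y; move: (sgn j y) => s ss.
  have E (a c w : C) : s * a * (s * c * w) = a * c * w.
    by transitivity (s * s * (a * c * w)); [ring | rewrite ss mul1r].
  rewrite !E; case: b d (y j) => [] [] [] /=;
    rewrite ?scale0r ?scale1r ?(mul0r, mulr0, mul1r, addr0, add0r, oppr0, addNr) //.
have ji : (j == i) = false by rewrite eq_sym; exact: negPf.
rewrite scale0r addr0 flipC !sgn_flip /flip (negPf ij) ji /=.
have [ij'|ji'|e] := ltngtP i j; last by rewrite e eqxx in ij.
- by rewrite !expr0 expr1; ring.
- by rewrite !expr0 expr1; ring.
Qed.

Lemma raise_linear k : linear (raise k).
Proof.
by move=> a f g; apply: funext => -[x y]; rewrite /raise !fctE /= mulrDr mulrCA.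
Qed.

Lemma lower_linear k : linear (lower k).
Proof. by move=> a f g; apply: funext. Qed.

Lemma toggle_linear i b : linear (toggle i b).
Proof.
by move=> a f g; apply: funext => -[x y]; rewrite /toggle !fctE /= mulrDr mulrCA.
Qed.

Lemma raise_toggle k i b f : raise k (toggle i b f) = toggle i b (raise k f).
Proof. by apply: funext => -[x y]; rewrite /raise /toggle /= mulrCA. Qed.

Lemma lower_toggle k i b f : lower k (toggle i b f) = toggle i b (lower k f).
Proof. by []. Qed.

Lemma obos_linear s n : linear (obos s n).
Proof.
move=> a f g; rewrite /obos.
have lm (c : C) (u v : P) : c *: (a *: u + v) = a *: (c *: u) + c *: v.
  by rewrite scalerDr !scalerA mulrC.
by case: eqP => // _; case: s; case: ifP => _; rewrite ?raise_linear ?lower_linear.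
Qed.

Lemma ofer_linear s n : linear (ofer s n).
Proof. exact: toggle_linear. Qed.

Lemma obos_ofer s t m n f : obos s m (ofer t n f) = ofer t n (obos s m f).
Proof.
have tL := linZ (toggle_linear (pickle (if t then n else - n - 1)) (n < 0)).
rewrite /obos /ofer; case: eqP => _; first by rewrite tL.
by case: s; case: ifP => _; rewrite ?tL ?raise_toggle ?lower_toggle.
Qed.

Lemma ofer_ofer s t m n f : ofer s m (ofer t n f) =
  - ofer t n (ofer s m f) + ((s != t) && (m + n + 1 == 0))%:R *: f.
Proof.
rewrite /ofer toggle_toggle; congr (_ + _%:R *: _).
rewrite (inj_eq (pcan_inj pickleK)).
by case: s; case: t => /=; case: (ltrP m 0) => m0; case: (ltrP n 0) => n0 //=; lia.
Qed.

Lemma obos_obos s t m n f : obos s m (obos t n f) = obos t n (obos s m f)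
  + (((s != t) && (m + n == 0))%:R * m%:~R) *: f.
Proof.
have rZ k := linZ (raise_linear k); have lZ k := linZ (lower_linear k).
rewrite /obos; case: (eqVneq m 0) => [->|m0].
  rewrite mulr0 scale0r addr0; case: ifP => _; first by rewrite !scalerA mulrC.
  by case: t; case: ifP => _; rewrite ?rZ ?lZ // !scalerA mulrC.
case: (eqVneq n 0) => [->|n0].
  rewrite addr0 (negPf m0) andbF mul0r scale0r addr0.
  by case: s; case: ifP => _; rewrite ?rZ ?lZ // !scalerA mulrC.
have e1 : (m == - n) = (m + n == 0) by lia.
have e2 : (- m == n) = (m + n == 0) by lia.
have e3 : (n == - m) = (m + n == 0) by lia.
have e4 : (- n == m) = (m + n == 0) by lia.
have e5 : (- m == - n) = (m == n) by lia.
have e6 : (- n == - m) = (m == n) by lia.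
have e7 : (n == m) = (m == n) by lia.
have e8 : (m < 0) != (n < 0) -> (m == n) = false by lia.
have [mn|mn] := eqVneq (m + n) 0.
  have nE : n = - m by lia.
  case: s; case: t; case: (ltrP m 0) e8 => m0'; case: (ltrP n 0) => n0' /=; try lia; move=> e8;
  rewrite ?rZ ?lZ ?lower_raise ?(e1, e2, e3, e4, e5, e6, e7) ?e8 ?mn ?eqxx
    ?(raiseC m) ?(raiseC (- m)) ?(lowerC m) ?(lowerC (- m)) //;
  rewrite nE ?opprK ?rmorphN /=; lmod_with (C : pzRingType) ((occ -> C^o) : lmodType C); ring.
case: s; case: t; case: (ltrP m 0) e8 => m0'; case: (ltrP n 0) => n0' /= e8;
  rewrite ?rZ ?lZ ?lower_raise ?(e1, e2, e3, e4, e5, e6, e7) ?(negPf mn) ?e8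
    ?(raiseC m) ?(raiseC (- m)) ?(lowerC m) ?(lowerC (- m)) //;
  lmod_with (C : pzRingType) ((occ -> C^o) : lmodType C); ring.
Qed.

Lemma obos_vac s (n : int) : 0 < n -> obos s n ovac = 0.
Proof.
have lv k : lower k ovac = 0.
  apply: funext => -[x y]; rewrite /lower /ovac /=.
  by case: asboolP => // -[/(congr1 (@^~ k))]; rewrite /shift eqxx.
by move=> n0; rewrite /obos gt_eqF // ltNge ltW //= !lv scaler0 if_same.
Qed.

Lemma ofer_vac s (n : int) : 0 <= n -> ofer s n ovac = 0.
Proof.
move=> n0; apply: funext => -[x y]; rewrite /ofer /toggle /ovac ltNge n0 /=.
set i := pickle _; case: asboolP => [[_ /(congr1 (@^~ i))]|_]; last by rewrite mulr0.
by rewrite /flip eqxx; case: (y i) => // _; rewrite mulr0 mul0r.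
Qed.

Lemma ovac_neq0 : ovac != 0.
Proof.
apply/eqP => /(congr1 (@^~ (fun=> 0%N, fun=> false))); rewrite /ovac /=.
by case: asboolP => // _ /eqP; rewrite oner_eq0.
Qed.

(* Functions of infinite support are excluded in order to have the induction     *)
(* principle ff_ind, from which local finiteness follows.                        *)
Inductive generated : P -> Prop :=
  | gen_vac : generated ovac
  | genD f g : generated f -> generated g -> generated (f + g)
  | genZ a f : generated f -> generated (a *: f)
  | gen_bos s n f : generated f -> generated (obos s n f)
  | gen_fer s n f : generated f -> generated (ofer s n f).

Definition fock : {pred P} := fun f => `[< generated f >].

Lemma fockP f : reflect (generated f) (f \in fock).
Proof. exact: asboolP. Qed.

Lemma fock_submod : submod_closed fock.
Proof.
split=> [|a f g /fockP ff /fockP fg]; apply/fockP.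
  by rewrite -(scale0r ovac); apply/genZ/gen_vac.
exact/genD/fg/genZ.
Qed.
HB.instance Definition _ := GRing.isSubmodClosed.Build C P fock fock_submod.

Record fock_space := Fock { fock_val : P; _ : fock_val \in fock }.
HB.instance Definition _ := [isSub for fock_val].
HB.instance Definition _ := [Choice of fock_space by <:].
HB.instance Definition _ := [SubChoice_isSubLmodule of fock_space by <:].

Section Restriction.
Variable T : P -> P.
Hypotheses (TL : linear T) (Tgen : forall f, generated f -> generated (T f)).

Lemma restr_subproof (u : fock_space) : T (val u) \in fock.
Proof. by apply/fockP/Tgen/fockP/(valP u). Qed.

Definition restr_fun (u : fock_space) : fock_space := Sub (T (val u)) (restr_subproof u).

Lemma restr_linear : linear restr_fun.
Proof.
move=> a u v; apply: val_inj; exact: (TL a (val u) (val v)).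
Qed.
Definition restr : {linear fock_space -> fock_space} :=
  HB.pack_for {linear fock_space -> fock_space} restr_fun
    (GRing.isLinear.Build C fock_space fock_space *:%R restr_fun restr_linear).
End Restriction.

Definition fbos s n : {linear fock_space -> fock_space} :=
  restr (obos_linear s n) (@gen_bos s n).
Definition ffer s n : {linear fock_space -> fock_space} :=
  restr (ofer_linear s n) (@gen_fer s n).
Definition fvac : fock_space := Sub ovac (introT (fockP _) gen_vac).

Lemma fock_ind (Q : fock_space -> Prop) : Q fvac ->
  (forall u v, Q u -> Q v -> Q (u + v)) -> (forall a u, Q u -> Q (a *: u)) ->
  (forall s n u, Q u -> Q (fbos s n u)) -> (forall s n u, Q u -> Q (ffer s n u)) ->
  forall u, Q u.
Proof.
move=> Qvac QD QZ Qbos Qfer [f ff]; have gf := fockP _ ff.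
elim: gf ff => {f} [|f g gf IHf gg IHg|a f gf IHf|s n f gf IHf|s n f gf IHf] ff.
- by rewrite (_ : Fock ff = fvac) //; apply: val_inj.
- rewrite (_ : Fock ff = Fock (introT (fockP f) gf) + Fock (introT (fockP g) gg)).
    exact: QD.
  exact: val_inj.
- rewrite (_ : Fock ff = a *: Fock (introT (fockP f) gf)); first exact: QZ.
  exact: val_inj.
- rewrite (_ : Fock ff = fbos s n (Fock (introT (fockP f) gf))); first exact: Qbos.
  exact: val_inj.
- rewrite (_ : Fock ff = ffer s n (Fock (introT (fockP f) gf))); first exact: Qfer.
  exact: val_inj.
Qed.

Program Definition fock_fields : freeFields R :=
  @FreeFields R fock_space fbos ffer z fvac _ _ _ _ _ _ _ _.
Next Obligation. by apply: val_inj; rewrite /= /obos eqxx. Qed.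
Next Obligation. by apply: val_inj; exact: obos_obos. Qed.
Next Obligation. by apply: val_inj; exact: obos_ofer. Qed.
Next Obligation. by apply: val_inj; exact: ofer_ofer. Qed.
Next Obligation.
by apply/eqP => /(congr1 val); exact/eqP/ovac_neq0.
Qed.
Next Obligation. by apply: val_inj; exact: obos_vac. Qed.
Next Obligation. by apply: val_inj; exact: ofer_vac. Qed.
Next Obligation. exact: fock_ind u. Qed.
End Occupation.

(** * Highest weight vectors in the free field modules *)

Section FockHighestWeight.
Variables (R : realType) (F : freeFields R) (e : bool -> R[i]) (q : nat).
Local Notation M := (ff_module F e).
Local Notation c := (e true).
Local Notation p := (q.*2.+1).
Local Notation vac := (vac F : M).
Hypotheses (c0 : c != 0) (zE : zmode F true = (1 + p%:R) * c).

Lemma ff_charges : has_charges M (charge e) c.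
Proof. by []. Qed.

Lemma alphaPsi_vacuum_vac : alphaPsi_vacuum c p%:R vac.
Proof.
split=> [n n0||n n0]; first exact: bos_vac.
  by rewrite /= bos0 zE.
exact: fer_vac.
Qed.

Lemma vac_highest_weight :
  highest_weight (vacuum_weight F e) ((1 + p%:R) * c) vac.
Proof.
split; [|exact: Lop0_vac|by case: alphaPsi_vacuum_vac].
by apply: (alphaPsi_vacuum_SHplus c0 alphaPsi_vacuum_vac) => m; exact: Gop_vac.
Qed.

Lemma phi_vac_neq0 : phi c q.+1 vac != 0.
Proof.
apply/eqP => phi0; have /eqP := vac_neq0 F; apply.
have <- : fer F false q%:Z (phi c q.+1 vac) = vac; last by rewrite phi0 linear0.
apply: (fermion_phi ff_charges c0 (linearP (fer F false q%:Z))).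
- by move=> n v; rewrite /= bos_fer.
- by move=> n v; rewrite /= fer_fer; congr (_ + _%:R *: _); lia.
- exact: fer_vac.
Qed.

Lemma phi_vac_highest_weight :
  highest_weight (vacuum_weight F e + p%:R / 2%:R) ((1 + p%:R) * c) (phi c q.+1 vac).
Proof.
have gphi := alphaPsi_vacuum_phi ff_charges q.+1 alphaPsi_vacuum_vac.
split; [|rewrite (L0_phi ff_charges)|by case: gphi].
  apply: (alphaPsi_vacuum_SHplus c0 gphi) => m.
  by apply: (G_phi_singular ff_charges c0 alphaPsi_vacuum_vac) => k; exact: Gop_vac.
rewrite [act _ _ vac]Lop0_vac (linZ (phi_linear ff_charges _)) -scalerDl; congr (_ *: _).
by rewrite -[q.*2.+1]addn1 -[q.+1]addn1 -muln2 !natrD natrM; field.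
Qed.

Lemma w_pr_phi_vac_neq0 : w_pr c p (phi c q.+1 vac) != 0.
Proof.
have gphi := alphaPsi_vacuum_phi ff_charges q.+1 alphaPsi_vacuum_vac.
have Tal n (v : M) : bos F false p%:Z (act M (SH_alpha n) v) =
    act M (SH_alpha n) (bos F false p%:Z v) + ((n == - p%:Z)%:R * p%:R) *: v.
  by rewrite /= bos_bos; congr (_ + (_%:R * _) *: _); lia.
have Tps n (v : M) : bos F false p%:Z (act M (SH_Psi n) v) =
    act M (SH_Psi n) (bos F false p%:Z v) by rewrite /= bos_fer.
have TL := linearP (bos F false p%:Z).
have Tphi : bos F false p%:Z (phi c q.+1 vac) = 0.
  rewrite (boson_phi ff_charges c0 TL Tal Tps); last by rewrite ltnS -addnn leq_addr.
  by rewrite bos_vac // (lin0 (phi_linear ff_charges _)).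
apply/eqP => w0; have /esym/eqP := boson_w_pr ff_charges c0 TL Tal Tps Tphi gphi.
by rewrite w0 linear0 scaler_eq0 oppr_eq0 invr_eq0 (negPf c0) (negPf phi_vac_neq0).
Qed.
End FockHighestWeight.

(** The background charge [d] is fixed by the central charge. The zero mode of the conjugate boson
    then enters the vacuum weight with coefficient pc, so any h is reached because p and c are
    nonzero. *)
Lemma exists_free_fields (R : realType) (cL c p h : R[i]) : c != 0 -> p != 0 ->
  exists (F : freeFields R) (e : bool -> R[i]),
    [/\ charge e = cL, e true = c, zmode F true = (1 + p) * c & vacuum_weight F e = h].
Proof.
move=> c0 p0; pose d := (3%:R - cL) / (24%:R * c).
exists (fock_fields (fun s => if s then (1 + p) * c else (h + (1 + p) * c * d) / (p * c))).
exists (fun s => if s then c else d); split=> //.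
  by rewrite /charge /= /d; field.
by rewrite /vacuum_weight /=; field; rewrite ?p0 ?c0.
Qed.

Lemma morph_w_pr (R : realType) (V W : SHmodule R) (cL c : R[i]) (q : nat)
    (f : {linear V -> W}) (v : V) :
  c != 0 -> has_charges V cL c -> has_charges W cL c ->
  (forall x u, f (act V x u) = act W x (f u)) ->
  alphaPsi_vacuum c q.*2.+1%:R v -> f (w_pr c q.*2.+1 v) = w_pr c q.*2.+1 (f v).
Proof.
move=> c0 chV chW fE gv.
have gw : alphaPsi_vacuum c q.*2.+1%:R (f v).
  case: gv => a1 a0 p0; split=> [n n0||n n0]; rewrite -fE.
  - by rewrite a1 // linear0.
  - by rewrite a0 linearZ.
  - by rewrite p0 // linear0.
rewrite (w_pr_phi chV c0 gv) (w_pr_phi chW c0 gw) linearD !linear_sum /=.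
congr (_ + _); apply: eq_bigr => k _.
  by rewrite !(morph_schur chV chW fE).
by rewrite linearZ /= !(morph_phi chV chW fE).
Qed.

Theorem proposition4p3 (R : realType) (cL cLa : R[i]) (hcLa : cLa != 0)
    (p : nat) (hp : (0 < p)%N) (hodd : odd p) (r : R[i])
    (V : SHmodule R) (v : V) (hV : is_V_pr cL cLa p%:R r v) :
  [/\ w_pr cLa p v != 0,
      subsingular (w_pr cLa p v),
      act V (SH_L 0) (w_pr cLa p v) =
        (h_pr cL p%:R r + p%:R) *: w_pr cLa p v &
      h_pr cL p%:R r + p%:R = h_pr cL p%:R (r - 1)].
Proof.
have [q pE] : exists q, p = q.*2.+1 by exists p./2; rewrite -[LHS]odd_double_half hodd.
subst p; set p := q.*2.+1 in hV *; set h := h_pr cL p%:R r in hV *.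
have p0 : p%:R != 0 :> R[i] by rewrite pnatr_eq0.
have [chV [plus_v L0v al0v] _ univ] := hV.
have gv : alphaPsi_vacuum cLa p%:R v.
  split=> [n n0||n n0] //; first exact: (plus_v (SH_alpha n)).
  exact: (plus_v (SH_Psi n)).
have Gv (m : nat) : act V (SH_G m%:Z) v = 0 by exact: (plus_v (SH_G m)).
have phi_neq0 : phi cLa q.+1 v != 0.
  have [F [e [ceq eE zE hE]]] := exists_free_fields cL h hcLa p0.
  have eT : e true != 0 by rewrite eE.
  have chM : has_charges (ff_module F e) cL cLa by rewrite -ceq -eE; exact: ff_charges.
  have := @vac_highest_weight _ F e q eT; rewrite eE => /(_ zE); rewrite hE.
  move=> /(univ _ _ chM) [f [fE fv]].
  apply/eqP => phi0; have := @phi_vac_neq0 _ F e q eT; rewrite eE.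
  by rewrite -fv -(morph_phi chV chM fE) phi0 linear0 eqxx.
have [W [f [chW fE gfv Gfv [phifv wfv]]]] : exists (W : SHmodule R) (f : {linear V -> W}),
    [/\ has_charges W cL cLa, forall x u, f (act V x u) = act W x (f u),
        alphaPsi_vacuum cLa p%:R (f v), forall m : nat, act W (SH_G m%:Z) (f v) = 0 &
        phi cLa q.+1 (f v) = 0 /\ w_pr cLa p (f v) != 0].
  (* The vector [phi c q.+1 vac] lies p/2 above the vacuum, so it has weight h and can be the image
     of v. *)
  have [F [e [ceq eE zE hE]]] := exists_free_fields cL (h - p%:R / 2%:R) hcLa p0.
  have eT : e true != 0 by rewrite eE.
  have chM : has_charges (ff_module F e) cL cLa by rewrite -ceq -eE; exact: ff_charges.
  have := @phi_vac_highest_weight _ F e q eT; rewrite eE => /(_ zE); rewrite hE subrK => hw.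
  have [f [fE fv]] := univ _ _ chM hw.
  have [plus_fv _ al0fv] := hw.
  exists (ff_module F e), f; rewrite fv; split=> //.
  - split=> [n n0||n n0] //; first exact: (plus_fv (SH_alpha n)).
    exact: (plus_fv (SH_Psi n)).
  - by move=> m; exact: (plus_fv (SH_G m)).
  split; last by have := @w_pr_phi_vac_neq0 _ F e q eT; rewrite eE => /(_ zE).
  (* [phi c q.+1] anticommutes with itself, so twice its square is zero. *)
  set u := phi _ _ _; have /eqP := phiC chM q.+1 q.+1 (vac F : ff_module F e).
  by rewrite -subr_eq0 opprK -mulr2n -scaler_nat scaler_eq0 pnatr_eq0 => /eqP.
have fw : f (w_pr cLa p v) = w_pr cLa p (f v) by exact: (morph_w_pr hcLa chV chW fE gv).
have wv : w_pr cLa p v != 0.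
  by apply: contraNneq wfv => w0; rewrite -fw w0 linear0.
split=> //.
- split.
    (* G(q+1/2) w = -(1/c) [phi c q.+1 v], which is nonzero. *)
    case=> _ /(_ (SH_G q) isT) /eqP; rewrite (G_w_pr chV hcLa gv Gv) leqnn subnn schur0.
    by rewrite scaler_eq0 oppr_eq0 invr_eq0 (negPf hcLa) (negPf phi_neq0).
  (* The submodule is the kernel of f: it contains [phi c q.+1 v] but not w. *)
  exists (fun u => f u == 0); split.
  - split; last by move=> x u; rewrite !unfold_in fE => /eqP->; rewrite linear0.
    split; first by rewrite unfold_in linear0.
    by move=> a u u'; rewrite !unfold_in linearP => /eqP-> /eqP->; rewrite scaler0 addr0.
  - by rewrite unfold_in fw.
  move=> x plus_x; rewrite unfold_in fE fw.
  rewrite (alphaPsi_vacuum_SHplus hcLa (alphaPsi_vacuum_w_pr chW hcLa gfv) _ plus_x) // => m.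
  rewrite (G_w_pr chW hcLa gfv Gfv) phifv; case: ifP => // _.
  by rewrite (lin0 (schur_beta_linear chW _)) scaler0.
- exact: (L0_w_pr chV hcLa gv L0v).
- by rewrite /h /h_pr; ring.
Qed.
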